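(* Let $(M,\tilde\varphi,\xi,\eta,\tilde g)$ be a paracontact $(\tilde\kappa,\tilde\mu)$-manifold with $\tilde\kappa<-1$, and set $\tilde\lambda=\sqrt{-1-\tilde\kappa}$; assume the index of $\mathcal D_{\tilde\varphi\tilde h}(\pm\tilde\lambda)$ is constant on $M$. Then the eigendistributions $\mathcal D_{\tilde\varphi\tilde h}(\tilde\lambda)$ and $\mathcal D_{\tilde\varphi\tilde h}(-\tilde\lambda)$ of the operator $\tilde\varphi\tilde h$ are integrable and define two mutually orthogonal Legendre foliations of $M$ with totally umbilical leaves. Moreover, for any $X,Y\in\Gamma(\mathcal D_{\tilde\varphi\tilde h}(\pm\tilde\lambda))$ (same sign for $X$ and $Y$), $\tilde\nabla_XY\in\Gamma(\mathcal D_{\tilde\varphi\tilde h}(\pm\tilde\lambda)\oplus\mathbb R\xi)$.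
   Context: Conventions: $2d\eta(X,Y)=X(\eta(Y))-Y(\eta(X))-\eta([X,Y])$; $R_{XY}Z=\nabla_X\nabla_YZ-\nabla_Y\nabla_XZ-\nabla_{[X,Y]}Z$; $\tilde\nabla$ is the Levi-Civita connection of $\tilde g$. An almost paracontact structure on a $(2n+1)$-dimensional manifold $M$ is $(\tilde\varphi,\xi,\eta)$, with $\tilde\varphi$ a $(1,1)$-tensor field, $\xi$ a vector field, $\eta$ a 1-form, such that $\eta(\xi)=1$, $\tilde\varphi^2=I-\eta\otimes\xi$ and the $\pm1$-eigendistributions of $\tilde\varphi$ on $\mathcal D=\ker\eta$ both have dimension $n$. With a pseudo-Riemannian metric $\tilde g$ satisfying $\tilde g(\tilde\varphi X,\tilde\varphi Y)=-\tilde g(X,Y)+\eta(X)\eta(Y)$ and $d\eta(X,Y)=\tilde g(X,\tilde\varphi Y)$ it is a paracontact metric structure. Put $\tilde h=\frac12\mathcal L_\xi\tilde\varphi$. A paracontact $(\tilde\kappa,\tilde\mu)$-manifold ($\tilde\kappa,\tilde\mu$ real constants) is a paracontact metric manifold whose curvature tensor satisfies $\tilde R_{XY}\xi=\tilde\kappa(\eta(Y)X-\eta(X)Y)+\tilde\mu(\eta(Y)\tilde hX-\eta(X)\tilde hY)$ for all vector fields $X,Y$. When $\tilde\kappa<-1$, $\tilde\varphi\tilde h$ is diagonalizable with eigenvalues $0$ (eigenspace $\mathbb R\xi$) and $\pm\tilde\lambda$ (each of multiplicity $n$); $\mathcal D_{\tilde\varphi\tilde h}(\pm\tilde\lambda)$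 denote the $\pm\tilde\lambda$-eigendistributions, and the index is that of the restriction of $\tilde g$. A Legendre foliation of $(M,\eta)$ is an $n$-dimensional integrable subbundle $L$ of $\mathcal D$ with $d\eta(X,X')=0$ for all $X,X'\in\Gamma(L)$. Its leaves are totally umbilical if their second fundamental form satisfies $B(X,X')=\tilde g(X,X')H$ for a normal vector field $H$ (the mean curvature vector field). *)

(* Defs.v *)
From HB Require Import structures.
From mathcomp Require Import all_boot all_order all_algebra.
From mathcomp Require Import all_classical all_reals all_analysis.

Set Implicit Arguments.
Unset Strict Implicit.
Unset Printing Implicit Defensive.

Import Order.TTheory GRing.Theory Num.Theory.
Import numFieldNormedType.Exports.

Local Open Scope classical_set_scope.
Local Open Scope ring_scope.

(* A map is C^(k+1) on an open set U when it is differentiable at every point  *)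
(* of U and all its directional derivatives are C^k on U.                      *)
Fixpoint Ck_on (R : realType) (V W : normedModType R) (k : nat) (U : set V)
    (f : V -> W) : Prop :=
  match k with
  | 0 => forall x, U x -> {for x, continuous f}
  | k'.+1 => (forall x, U x -> differentiable f x) /\
             (forall v, Ck_on k' U ('D_v f))
  end.

Definition smooth_on (R : realType) (V W : normedModType R) (U : set V)
    (f : V -> W) : Prop := forall k, Ck_on k U f.

(* `cto` and `cfrom` are total functions; their values outside `cdom`, resp.   *)
(* `ccod`, are irrelevant.                                                     *)
Record chart (R : realType) (d : nat) (M : topologicalType) := Chart {
  cdom : set M;
  ccod : set 'rV[R]_d;
  cto : M -> 'rV[R]_d;
  cfrom : 'rV[R]_d -> M;
  cdom_open : open cdom;
  ccod_open : open ccod;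
  cto_in : forall p, cdom p -> ccod (cto p);
  cfrom_in : forall x, ccod x -> cdom (cfrom x);
  ctoK : forall p, cdom p -> cfrom (cto p) = p;
  cfromK : forall x, ccod x -> cto (cfrom x) = x;
  cto_continuous : forall p, cdom p -> {for p, continuous cto};
  cfrom_continuous : forall x, ccod x -> {for x, continuous cfrom} }.

(* A smooth manifold of dimension d. The preferred chart `chart_at p` around   *)
(* p identifies the tangent space at p with 'rV[R]_d, so a vector field is a   *)
(* map M -> 'rV[R]_d; smoothness is always tested in all charts of the atlas,  *)
(* after the change of frame `frame` below.                                    *)
Record manifold (R : realType) (d : nat) := Manifold {
  points :> topologicalType;
  manifold_hausdorff : hausdorff_space points;
  manifold_second_countable : @second_countable points;
  atlas : set (chart R d points);
  atlas_compat : forall e e', atlas e -> atlas e' ->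
    smooth_on (ccod e `&` cfrom e @^-1` cdom e') (cto e' \o cfrom e);
  chart_at : points -> chart R d points;
  chart_at_atlas : forall p, atlas (chart_at p);
  chart_at_dom : forall p, cdom (chart_at p) p }.

Arguments atlas {R d} m.
Arguments chart_at {R d} {m} p.

Section DifferentialGeometry.
Variables (R : realType) (d : nat) (M : manifold R d).

(* Row-vector convention: a (1,1)-tensor A maps a tangent vector v at p to     *)
(* v *m A p, so the composite "first A, then B" has matrix A p *m B p; a       *)
(* 1-form a maps v to (v *m a p) 0 0.                                          *)
Definition vfield := M -> 'rV[R]_d.
Definition form1 := M -> 'cV[R]_d.
Definition tensor11 := M -> 'M[R]_d.
Definition tensor02 := M -> 'M[R]_d.

Implicit Types (U : set M) (f : M -> R) (X Y Z : vfield) (eta : form1)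
  (A phi h : tensor11) (g : tensor02).

Definition papp (G : 'M[R]_d) (u v : 'rV[R]_d) : R := (u *m G *m v^T) 0 0.

Definition app11 A X : vfield := fun p => X p *m A p.
Definition app1 eta X : M -> R := fun p => (X p *m eta p) 0 0.
Definition app2 g X Y : M -> R := fun p => papp (g p) (X p) (Y p).

(* The differential at q of the transition map from the preferred chart at q   *)
(* to e: right multiplication by it turns components of a tangent vector at q  *)
(* into components in e.                                                       *)
Definition frame (e : chart R d M) (q : M) : 'M[R]_d :=
  'J (cto e \o cfrom (chart_at q)) (cto (chart_at q) q).

(* Components of tensor fields in the chart e. *)
Definition vf_rep (e : chart R d M) X (x : 'rV[R]_d) : 'rV[R]_d :=
  let q := cfrom e x in X q *m frame e q.
Definition form1_rep (e : chart R d M) eta (x : 'rV[R]_d) : 'cV[R]_d :=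
  let q := cfrom e x in invmx (frame e q) *m eta q.
Definition tensor11_rep (e : chart R d M) A (x : 'rV[R]_d) : 'M[R]_d :=
  let q := cfrom e x in invmx (frame e q) *m A q *m frame e q.
Definition tensor02_rep (e : chart R d M) g (x : 'rV[R]_d) : 'M[R]_d :=
  let q := cfrom e x in invmx (frame e q) *m g q *m (invmx (frame e q))^T.

Definition smooth_fun f :=
  forall e, atlas M e -> smooth_on (ccod e) (f \o cfrom e : 'rV[R]_d -> R^o).
Definition smooth_vf_on U X :=
  forall e, atlas M e -> smooth_on (ccod e `&` cfrom e @^-1` U) (vf_rep e X).
Definition smooth_vf X := smooth_vf_on setT X.
Definition smooth_form1 eta :=
  forall e, atlas M e -> smooth_on (ccod e) (form1_rep e eta).
Definition smooth_tensor11 A :=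
  forall e, atlas M e -> smooth_on (ccod e) (tensor11_rep e A).
Definition smooth_tensor02 g :=
  forall e, atlas M e -> smooth_on (ccod e) (tensor02_rep e g).

(* X(f) *)
Definition vf_der X f : M -> R := fun p =>
  'D_(X p) (f \o cfrom (chart_at p) : 'rV[R]_d -> R^o) (cto (chart_at p) p).

(* In components, [X,Y]^i = X^j d_j Y^i - Y^j d_j X^i; the chart is the        *)
(* preferred one at p, where X p and Y p are their own components.             *)
Definition lie_bracket X Y : vfield := fun p =>
  let e := chart_at p in let x := cto e p in
  'D_(X p) (vf_rep e Y) x - 'D_(Y p) (vf_rep e X) x.

Definition ext_d eta X Y : M -> R := fun p =>
  2^-1 * (vf_der X (app1 eta Y) p - vf_der Y (app1 eta X) p
          - app1 eta (lie_bracket X Y) p).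

(* A = L_X phi, i.e. A Y = [X, phi Y] - phi [X, Y] for all vector fields Y.    *)
Definition is_lie_derivative X phi A :=
  smooth_tensor11 A /\
  forall Y, smooth_vf Y -> forall p,
    app11 A Y p = lie_bracket X (app11 phi Y) p - app11 phi (lie_bracket X Y) p.

(* The index of the restriction to the row space of L of the symmetric         *)
(* bilinear form G: the largest dimension of a negative definite subspace.     *)
Definition index_on (G L : 'M[R]_d) : nat :=
  \max_(k < d.+1 | `[< exists W : 'M[R]_d,
      [/\ (W <= L)%MS, \rank W = k &
          forall u : 'rV[R]_d, (u <= W)%MS -> u != 0 -> papp G u u < 0] >]) k.

Definition constant_index g (L : M -> 'M[R]_d) :=
  exists k, forall p, index_on (g p) (L p) = k.

Definition pseudo_riemannian g :=
  [/\ smooth_tensor02 g,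
      forall p, (g p)^T = g p,
      forall p, g p \in unitmx &
      constant_index g (fun=> 1%:M)].

(* Connections are operators on all maps M -> 'rV[R]_d; only their values on   *)
(* smooth vector fields are meaningful.                                        *)
Definition affine_connection (nabla : vfield -> vfield -> vfield) :=
  [/\ forall X Y, smooth_vf X -> smooth_vf Y -> smooth_vf (nabla X Y),
      forall f X X' Y, smooth_fun f -> smooth_vf X -> smooth_vf X' ->
        smooth_vf Y -> forall p,
        nabla (fun q => f q *: X q + X' q) Y p
        = f p *: nabla X Y p + nabla X' Y p,
      forall X Y Y', smooth_vf X -> smooth_vf Y -> smooth_vf Y' -> forall p,
        nabla X (fun q => Y q + Y' q) p = nabla X Y p + nabla X Y' p &
      forall f X Y, smooth_fun f -> smooth_vf X -> smooth_vf Y -> forall p,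
        nabla X (fun q => f q *: Y q) p
        = vf_der X f p *: Y p + f p *: nabla X Y p].

Definition levi_civita g (nabla : vfield -> vfield -> vfield) :=
  [/\ affine_connection nabla,
      forall X Y, smooth_vf X -> smooth_vf Y -> forall p,
        nabla X Y p - nabla Y X p = lie_bracket X Y p &
      forall X Y Z, smooth_vf X -> smooth_vf Y -> smooth_vf Z -> forall p,
        vf_der X (app2 g Y Z) p
        = app2 g (nabla X Y) Z p + app2 g Y (nabla X Z) p].

Definition curvature (nabla : vfield -> vfield -> vfield) X Y Z : vfield :=
  fun p => nabla X (nabla Y Z) p - nabla Y (nabla X Z) p
           - nabla (lie_bracket X Y) Z p.

(* A distribution is a family of subspaces of the tangent spaces, each given   *)
(* as the row space of a matrix.                                               *)
Definition tangent_distribution := M -> 'M[R]_d.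
Implicit Types L : tangent_distribution.

Definition ker_form1 eta : tangent_distribution := fun p => kermx (eta p).

(* X is in Gamma(L) *)
Definition section_of L X := smooth_vf X /\ forall p, (X p <= L p)%MS.

Definition eigendistribution A (s : R) : tangent_distribution :=
  fun p => eigenspace (A p) s.

(* Smooth subbundle of rank k: around each point there is a smooth frame. *)
Definition subbundle (k : nat) L :=
  forall p, exists2 U : set M, open U /\ U p &
    exists2 F : 'I_k -> vfield, forall i, smooth_vf_on U (F i) &
      forall q, U q -> \rank (L q) = k /\
                       (\matrix_(i < k) F i q == L q)%MS.

(* Integrability of a subbundle is closure of its sections under the bracket;  *)
(* a foliation is an integrable subbundle.                                     *)
Definition integrable_subbundle L :=
  forall X Y, section_of L X -> section_of L Y -> section_of L (lie_bracket X Y).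

Definition legendre_foliation (n : nat) eta L :=
  [/\ subbundle n L,
      forall p, (L p <= ker_form1 eta p)%MS,
      integrable_subbundle L &
      forall X X', section_of L X -> section_of L X' ->
        forall p, ext_d eta X X' p = 0].

Definition orthogonal_distributions g L L' :=
  forall p (u v : 'rV[R]_d), (u <= L p)%MS -> (v <= L' p)%MS ->
    papp (g p) u v = 0.

Definition orthogonal_complement g L : tangent_distribution :=
  fun p => kermx (g p *m (L p)^T).

(* The component along the normal bundle of L, meaningful when the             *)
(* restriction of g to L is nondegenerate.                                     *)
Definition normal_part g L X : vfield := fun p =>
  X p *m proj_mx (orthogonal_complement g L p) (L p).

(* The second fundamental form of the leaves, on vector fields tangent to the  *)
(* foliation.                                                                  *)
Definition second_fundamental_form g (nabla : vfield -> vfield -> vfield) L X X'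
  : vfield := normal_part g L (nabla X X').

(* The first clause says that the leaves are pseudo-Riemannian submanifolds,   *)
(* without which their second fundamental form is not defined.                 *)
Definition totally_umbilical_leaves g (nabla : vfield -> vfield -> vfield) L :=
  (forall p, (L p :&: orthogonal_complement g L p)%MS = 0) /\
  exists2 H : vfield, section_of (orthogonal_complement g L) H &
    forall X X', section_of L X -> section_of L X' -> forall p,
      second_fundamental_form g nabla L X X' p = app2 g X X' p *: H p.

End DifferentialGeometry.

Section Paracontact.
Variables (R : realType) (n : nat) (M : manifold R n.*2.+1).

Record almost_paracontact (phi : tensor11 M) (xi : vfield M) (eta : form1 M) := {
  apc_phi : smooth_tensor11 phi;
  apc_xi : smooth_vf xi;
  apc_eta : smooth_form1 eta;
  apc_eta_xi : forall p, app1 eta xi p = 1;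
  apc_phi2 : forall p, phi p *m phi p = 1%:M - eta p *m xi p;
  apc_rank_pos : forall p,
    \rank (eigendistribution phi 1 p :&: ker_form1 eta p)%MS = n;
  apc_rank_neg : forall p,
    \rank (eigendistribution phi (-1) p :&: ker_form1 eta p)%MS = n }.

Record paracontact_metric (phi : tensor11 M) (xi : vfield M) (eta : form1 M)
    (g : tensor02 M) := {
  pcm_apc : almost_paracontact phi xi eta;
  pcm_metric : pseudo_riemannian g;
  pcm_compat : forall X Y, smooth_vf X -> smooth_vf Y -> forall p,
    app2 g (app11 phi X) (app11 phi Y) p
    = - app2 g X Y p + app1 eta X p * app1 eta Y p;
  pcm_contact : forall X Y, smooth_vf X -> smooth_vf Y -> forall p,
    ext_d eta X Y p = app2 g X (app11 phi Y) p }.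

(* h is (1/2) L_xi phi, nabla the Levi-Civita connection of g. *)
Record paracontact_kappa_mu (kappa mu : R) (phi : tensor11 M) (xi : vfield M)
    (eta : form1 M) (g : tensor02 M) (h : tensor11 M)
    (nabla : vfield M -> vfield M -> vfield M) := {
  pkm_pcm : paracontact_metric phi xi eta g;
  pkm_h : is_lie_derivative xi phi (fun p => 2 *: h p);
  pkm_nabla : levi_civita g nabla;
  pkm_curvature : forall X Y, smooth_vf X -> smooth_vf Y -> forall p,
    curvature nabla X Y xi p
    = kappa *: (app1 eta Y p *: X p - app1 eta X p *: Y p)
      + mu *: (app1 eta Y p *: app11 h X p - app1 eta X p *: app11 h Y p) }.

(* The operator phi h (first h, then phi). *)
Definition phi_h (phi h : tensor11 M) : tensor11 M := fun p => h p *m phi p.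

End Paracontact.

(* Main.v *)
Require Import Defs.
From HB Require Import structures.
From mathcomp Require Import all_boot all_order all_algebra.
From mathcomp Require Import all_classical all_reals all_analysis.
From mathcomp Require Import ring lra zify.

Set Implicit Arguments.
Unset Strict Implicit.
Unset Printing Implicit Defensive.

Import Order.TTheory GRing.Theory Num.Theory.
Import numFieldNormedType.Exports.

Local Open Scope classical_set_scope.
Local Open Scope ring_scope.

(** Put S X = nabla_X xi + phi X. Since eta = g(., xi), the skew part of
    nabla xi is d eta, that is - phi, so S is g-symmetric, and S xi = 0.
    Closedness of d eta, with xi as one argument, says that nabla_xi phi is
    the opposite of phi S + S phi; the first anticommutes with phi, the second
    commutes with it, so both vanish ([dphi_xi0], [shapeP]). It follows that
    h = phi S, hence S = phi h, and nabla_X xi = phi h X - phi X ([h_shape]).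

    The curvature condition for R(Y, xi) xi is a Riccati equation for S, whose
    part commuting with phi is S^2 = (- 1 - kappa) phi^2 ([shape_shape]). So,
    with lambda^2 = - 1 - kappa, the tangent spaces split orthogonally into
    the line of xi and the eigenspaces of S for lambda and - lambda; phi
    exchanges the latter, because it anticommutes with S, so both have
    dimension n ([eigen_rank]).

    For horizontal X and Y the curvature condition reads R(X, Y) xi = 0, a
    Codazzi equation relating nabla S and nabla phi ([codazzi]). Let a, b, c
    be eigenfields for the same eigenvalue s. Then g((nabla_a phi) b, phi c)
    is symmetric in a and b by the Codazzi equation, and skew in b and c, so
    it is zero. By the Codazzi equation again g(nabla_a b, phi c) is a nonzero
    multiple of this form with a and b exchanged, and phi c runs through the
    eigenspace of - s ([nabla_eigenfield]). Hence nabla_X Y lies in the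
    sum of the eigendistribution of X and Y and of the line of xi. Its
    component along xi is - s g(X, Y) ([nabla_xi_component]): it is symmetric
    in X and Y, which gives integrability, and it is the second fundamental
    form, with mean curvature field - s xi.

    These computations are carried out on global smooth vector fields. The
    passage to single tangent vectors needs a smooth field through any given
    vector ([vf_through]), obtained by cutting off with a bump function;
    closedness of d eta needs the bracket to be the commutator of derivations
    ([vf_der_bracket]), which rests on the symmetry of second derivatives
    ([derive_swap]), and the Jacobi identity ([jacobi_identity]). *)

(** * Calculus of functions of class C^k *)

Section SmoothCalculus.
Context {R : realType}.

Lemma near_eq_differentiable (V W : normedModType R) (f g : V -> W) (x : V) :
  (\forall y \near x, f y = g y) -> differentiable f x -> differentiable g x.
Proof.
move=> fg df; have fgx : f x = g x by exact: (nbhs_singleton fg).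
have [cdf eqf] := (diff_locallyP x f).1 df.
have eqg : g \o shift x = cst (g x) + 'd f x +o_ (nbhs (0 : V)) id.
  apply/eqaddoP => e e0; move/eqaddoP: eqf => /(_ e e0) eqf.
  have shx : (y + x) @[y --> (0 : V)] --> x.
    by rewrite -{2}[x]add0r; apply: cvgD; [exact: cvg_id|exact: cvg_cst].
  near=> y.
  have -> : (g \o shift x - (cst (g x) + 'd f x)) y =
            (f \o shift x - (cst (f x) + 'd f x)) y.
    rewrite -fgx /= !fctE /=; congr (_ - _).
    by apply/esym; near: y; exact: (shx _ fg).
  by near: y.
have dgf := diff_unique cdf eqg.
by apply/diff_locallyP; rewrite dgf.
Unshelve. all: by end_near. Qed.

(** Functions can be glued from pieces of class C^k: if f and g agree on an
    open set, so do their directional derivatives, and the induction goes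
    through. *)
Lemma Ck_on_local (V W : normedModType R) k (U : set V) (f : V -> W) :
  (forall x, U x -> exists2 O : set V, open O /\ O x &
     exists2 g : V -> W, Ck_on k O g & forall y, O y -> f y = g y) ->
  Ck_on k U f.
Proof.
have nearO (O : set V) (x : V) (g h : V -> W) : open O -> O x ->
    (forall y, O y -> g y = h y) -> \forall y \near x, g y = h y.
  by move=> oO Ox gh; near=> y; apply: gh; near: y; exact: open_nbhs_nbhs.
elim: k f => [|k IH] f loc /=.
  move=> x /loc[N [oO Ox] [g /(_ x Ox) cg fg]].
  have gf := nearO N x _ _ oO Ox (fun y Oy => esym (fg y Oy)).
  rewrite /prop_for /continuous_at (fg x Ox).
  by apply: cvg_trans cg; exact: near_eq_cvg.
split=> [x Ux|v].
  have [N [oO Ox] [g [dg _] fg]] := loc x Ux.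
  apply: (near_eq_differentiable _ (dg x Ox)).
  exact: (nearO N x _ _ oO Ox (fun y Oy => esym (fg y Oy))).
apply: IH => x Ux; have [N [oO Ox] [g [_ Dg] fg]] := loc x Ux.
exists N => //; exists ('D_v g); first exact: Dg.
move=> y Oy.
by apply: near_eq_derive; exact: (nearO N y _ _ oO Oy fg).
Unshelve. all: by end_near. Qed.

Lemma Ck_on_eq (V W : normedModType R) k (U : set V) (f g : V -> W) :
  open U -> (forall x, U x -> f x = g x) -> Ck_on k U g -> Ck_on k U f.
Proof. by move=> oU fg Cg; apply: Ck_on_local => x Ux; exists U => //; exists g. Qed.

Lemma Ck_onS (V W : normedModType R) k (U U' : set V) (f : V -> W) :
  U' `<=` U -> Ck_on k U f -> Ck_on k U' f.
Proof.
move=> UU'; elim: k f => [|k IH] f /=; first by move=> Cf x /UU'/Cf.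
by move=> [df Df]; split=> [x /UU'/df//|v]; exact: IH.
Qed.

Lemma Ck_on_pred (V W : normedModType R) k (U : set V) (f : V -> W) :
  Ck_on k.+1 U f -> Ck_on k U f.
Proof.
elim: k f => [|k IH] f /= [df Df].
  by move=> x Ux; exact: (differentiable_continuous (df x Ux)).
by split=> // v; apply: IH; exact: Df.
Qed.

Lemma Ck_on_cst (V W : normedModType R) k (U : set V) (c : W) :
  Ck_on k U (fun _ : V => c).
Proof.
elim: k c => [|k IH] c /=; first by move=> x Ux; exact: cvg_cst.
split=> [x Ux|v]; first exact: differentiable_cst.
suff -> : 'D_v (fun _ : V => c) = (fun=> 0) by exact: IH.
by apply/funext => x; exact: derive_cst.
Qed.

Lemma Ck_on_add (V W : normedModType R) k (U : set V) (f g : V -> W) :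
  open U -> Ck_on k U f -> Ck_on k U g -> Ck_on k U (fun x => f x + g x).
Proof.
move=> oU; elim: k f g => [|k IH] f g /=.
  by move=> Cf Cg x Ux; exact: (cvgD (Cf x Ux) (Cg x Ux)).
move=> [df Df] [dg Dg]; split=> [x Ux|v].
  exact: (differentiableD (df x Ux) (dg x Ux)).
apply: (Ck_on_eq oU) (IH _ _ (Df v) (Dg v)) => x Ux.
by apply: deriveD; apply: diff_derivable; [exact: df|exact: dg].
Qed.

Lemma Ck_on_mul (V : normedModType R) k (U : set V) (f g : V -> R^o) :
  open U -> Ck_on k U f -> Ck_on k U g ->
  Ck_on k U (fun x => f x * g x : R^o).
Proof.
move=> oU; elim: k f g => [|k IH] f g.
  by move=> Cf Cg x Ux; exact: (cvgM (Cf x Ux) (Cg x Ux)).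
move=> Cf Cg; have [df Df] := Cf; have [dg Dg] := Cg.
split=> [x Ux|v]; first exact: (differentiableM (df x Ux) (dg x Ux)).
have C := Ck_on_add oU (IH _ _ (Ck_on_pred Cf) (Dg v))
                       (IH _ _ (Ck_on_pred Cg) (Df v)).
apply: (Ck_on_eq oU) C => x Ux.
by apply: deriveM; apply: diff_derivable; [exact: df|exact: dg].
Qed.

Lemma Ck_on_sum (V W : normedModType R) (I : Type) (r : seq I) k (U : set V)
    (f : I -> V -> W) :
  open U -> (forall i, Ck_on k U (f i)) ->
  Ck_on k U (fun x => \sum_(i <- r) f i x).
Proof.
move=> oU Cf; elim: r => [|i r IH].
  rewrite (_ : (fun _ => _) = fun=> 0); first exact: Ck_on_cst.
  by apply/funext => x; rewrite big_nil.
rewrite (_ : (fun _ => _) = fun x => f i x + \sum_(i <- r) f i x).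
  exact: Ck_on_add.
by apply/funext => x; rewrite big_cons.
Qed.

Lemma Ck_on_prod (V : normedModType R) (I : Type) (r : seq I) k (U : set V)
    (f : I -> V -> R^o) :
  open U -> (forall i, Ck_on k U (f i)) ->
  Ck_on k U (fun x => \prod_(i <- r) f i x : R^o).
Proof.
move=> oU Cf; elim: r => [|i r IH].
  rewrite (_ : (fun _ => _) = fun=> 1); first exact: Ck_on_cst.
  by apply/funext => x; rewrite big_nil.
rewrite (_ : (fun _ => _) = fun x => f i x * \prod_(i <- r) f i x).
  exact: Ck_on_mul.
by apply/funext => x; rewrite big_cons.
Qed.

Lemma differentiable_mxP (V : normedModType R) m n (f : V -> 'M[R]_(m, n)) x :
  differentiable f x <->
  forall i j, differentiable (fun y => f y i j : R^o) x.
Proof.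
split=> [df i j|df].
  exact: (differentiable_comp df (differentiable_coord _ i j)).
rewrite (_ : f = \sum_(i < m) \sum_(j < n)
                   fun y => (f y i j : R) *: delta_mx i j); last first.
  apply/funext => y; rewrite {1}[f y]matrix_sum_delta fct_sumE.
  by apply: eq_bigr => i _; rewrite fct_sumE.
apply: differentiable_sum => i; apply: differentiable_sum => j.
exact: differentiableZl.
Qed.

(** Reduces matrix-valued calculus to sums and products of real functions. *)
Lemma Ck_on_mxP (V : normedModType R) m n k (U : set V)
    (f : V -> 'M[R]_(m, n)) : open U ->
  Ck_on k U f <-> forall i j, Ck_on k U (fun x => f x i j : R^o).
Proof.
move=> oU; elim: k f => [|k IH] f; split=> Cf.
- move=> i j x Ux; apply: (@continuous_comp _ _ _ f (fun A => A i j)).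
    exact: Cf.
  exact: coord_continuous.
- move=> x Ux A [P nP sPA]; apply: (filterS sPA) => /=.
  apply: filter_forall => i; apply: filter_forall => j.
  exact: (Cf i j x Ux _ (nP i j)).
- move=> i j; have [df Df] := Cf; split=> [x Ux|v].
    exact: ((differentiable_mxP f x).1 (df x Ux) i j).
  apply: (Ck_on_eq oU) ((IH _).1 (Df v) i j) => x Ux.
  by rewrite derive_mx ?mxE//; apply: diff_derivable; exact: df.
- have df x : U x -> differentiable f x.
    by move=> Ux; apply/differentiable_mxP => i j; case: (Cf i j) => /(_ x Ux).
  split=> // v; apply/IH => i j.
  apply: (Ck_on_eq oU) ((Cf i j).2 v) => x Ux.
  by rewrite derive_mx ?mxE//; apply: diff_derivable; exact: df.
Qed.

Lemma Ck_on_mulmx (V : normedModType R) m n q k (U : set V)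
    (f : V -> 'M[R]_(m, n)) (g : V -> 'M[R]_(n, q)) :
  open U -> Ck_on k U f -> Ck_on k U g -> Ck_on k U (fun x => f x *m g x).
Proof.
move=> oU /(Ck_on_mxP _ _ oU) Cf /(Ck_on_mxP _ _ oU) Cg.
apply/Ck_on_mxP => // i j.
rewrite (_ : (fun _ => _) = fun x => \sum_l (f x i l : R^o) * g x l j).
  by apply: Ck_on_sum => // l; exact: Ck_on_mul.
by apply/funext => x; rewrite mxE.
Qed.

Lemma Ck_on_tr (V : normedModType R) m n k (U : set V)
    (f : V -> 'M[R]_(m, n)) :
  open U -> Ck_on k U f -> Ck_on k U (fun x => (f x)^T).
Proof.
move=> oU /(Ck_on_mxP _ _ oU) Cf; apply/Ck_on_mxP => // i j.
by rewrite (_ : (fun _ => _) = fun x => f x j i) //; apply/funext => x; rewrite mxE.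
Qed.

Lemma Ck_on_scale (V : normedModType R) m n k (U : set V) (a : V -> R^o)
    (f : V -> 'M[R]_(m, n)) :
  open U -> Ck_on k U a -> Ck_on k U f -> Ck_on k U (fun x => a x *: f x).
Proof.
move=> oU Ca /(Ck_on_mxP _ _ oU) Cf; apply/Ck_on_mxP => // i j.
rewrite (_ : (fun _ => _) = fun x => a x * f x i j); first exact: Ck_on_mul.
by apply/funext => x; rewrite mxE.
Qed.

Lemma Ck_on_det (V : normedModType R) n k (U : set V) (f : V -> 'M[R]_n) :
  open U -> Ck_on k U f -> Ck_on k U (fun x => \det (f x) : R^o).
Proof.
move=> oU /(Ck_on_mxP _ _ oU) Cf; rewrite /determinant.
apply: Ck_on_sum => // s; apply: Ck_on_mul => //; first exact: Ck_on_cst.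
exact: Ck_on_prod.
Qed.

Lemma derive_dirB (V W : normedModType R) (f : V -> W) x u v :
  differentiable f x -> 'D_(u - v) f x = 'D_u f x - 'D_v f x.
Proof. by move=> df; rewrite !deriveE // linearB. Qed.

Lemma derive_dirD (V W : normedModType R) (f : V -> W) x u v :
  differentiable f x -> 'D_(u + v) f x = 'D_u f x + 'D_v f x.
Proof. by move=> df; rewrite !deriveE // linearD. Qed.

Lemma derive_delta d (W : normedModType R) (f : 'rV[R]_d -> W) x v :
  differentiable f x -> 'D_v f x = \sum_i v 0 i *: 'D_(delta_mx 0 i) f x.
Proof.
move=> df; rewrite deriveE // {1}(row_sum_delta v) linear_sum.
by apply: eq_bigr => i _; rewrite linearZ deriveE.
Qed.

Lemma derive_comp (V V' W : normedModType R) (f : V -> V')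
    (g : V' -> W) x v : differentiable f x -> differentiable g (f x) ->
  'D_v (g \o f) x = 'D_('D_v f x) g (f x).
Proof.
move=> df dg; have dgf : differentiable (g \o f) x by exact: differentiable_comp.
by rewrite !deriveE // diff_comp.
Qed.

(** Written with partial derivatives, the derivative of the composite is a
    sum of products of functions of class C^k, one factor of which is again a
    composite. *)
Lemma Ck_on_comp (V : normedModType R) d k (U : set V) (U' : set 'rV[R]_d)
    (f : V -> 'rV[R]_d) (g : 'rV[R]_d -> R^o) :
  open U -> (forall x, U x -> U' (f x)) -> Ck_on k U f -> Ck_on k U' g ->
  Ck_on k U (g \o f).
Proof.
move=> oU UU'; elim: k g => [|k IH] g Cf Cg.
  move=> x Ux; apply: continuous_comp; first exact: Cf.
  by apply: Cg; exact: UU'.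
have [df Df] := Cf; have [dg Dg] := Cg.
split=> [x Ux|v]; first exact: (differentiable_comp (df x Ux) (dg _ (UU' x Ux))).
apply: (Ck_on_eq oU) (_ : _ _ _ (fun x => \sum_i ('D_v f x) 0 i *
   ('D_(delta_mx 0 i) g \o f) x : R^o)) => [x Ux|].
  by rewrite derive_comp ?derive_delta; auto.
apply: Ck_on_sum => // i; apply: Ck_on_mul => //.
  exact: ((Ck_on_mxP k _ oU).1 (Df v) 0 i).
by apply: IH (Dg _); exact: Ck_on_pred.
Qed.

Lemma Ck_on_comp_mx (V : normedModType R) d m n k (U : set V)
    (U' : set 'rV[R]_d) (f : V -> 'rV[R]_d) (g : 'rV[R]_d -> 'M[R]_(m, n)) :
  open U -> open U' -> (forall x, U x -> U' (f x)) -> Ck_on k U f ->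
  Ck_on k U' g -> Ck_on k U (g \o f).
Proof.
move=> oU oU' UU' Cf /(Ck_on_mxP _ _ oU') Cg; apply/Ck_on_mxP => // i j.
exact: (Ck_on_comp oU UU' Cf (Cg i j)).
Qed.

Lemma Ck_on_id d k (U : set 'rV[R]_d) : Ck_on k U (@id 'rV[R]_d).
Proof.
case: k => [|k]; first by move=> x _; exact: cvg_id.
split=> [x _|v]; first exact: ex_diff.
suff -> : 'D_v (@id 'rV[R]_d) = fun=> v by exact: Ck_on_cst.
by apply/funext => x; rewrite derive_id.
Qed.

Lemma Ck_on_derive d k (U : set 'rV[R]_d) (v : 'rV[R]_d -> 'rV[R]_d)
    (f : 'rV[R]_d -> R^o) :
  open U -> Ck_on k U v -> Ck_on k.+1 U f ->
  Ck_on k U (fun x => 'D_(v x) f x).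
Proof.
move=> oU Cv [df Df].
apply: (Ck_on_eq oU) (_ : _ _ _
  (fun x => \sum_i v x 0 i * 'D_(delta_mx 0 i) f x : R^o)) => [x Ux|].
  by rewrite derive_delta; auto.
apply: Ck_on_sum => // i; apply: Ck_on_mul => //.
  exact: ((Ck_on_mxP k _ oU).1 Cv 0 i).
exact: Df.
Qed.

Lemma Ck_on_jacobian d d' k (U : set 'rV[R]_d) (f : 'rV[R]_d -> 'rV[R]_d') :
  open U -> Ck_on k.+1 U f -> Ck_on k U (jacobian f).
Proof.
move=> oU [df Df]; apply/Ck_on_mxP => // i j.
apply: (Ck_on_eq oU) ((Ck_on_mxP k _ oU).1 (Df (delta_mx 0 i)) 0 j) => x Ux.
by rewrite (deriveEjacobian _ (df x Ux)) -rowE [RHS]mxE.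
Qed.

Lemma is_derive_line (V W : normedModType R) (f : V -> W) (v y : V) (r : R^o) :
  differentiable f (r *: v + y) ->
  is_derive r (1 : R^o) (fun t : R^o => f (t *: v + y)) ('D_v f (r *: v + y)).
Proof.
move=> df; pose c (t : R^o) := t *: v + y.
have dl : differentiable (fun t : R^o => t *: v) r.
  exact: (differentiableZl _ (ex_diff (f := @id R^o))).
have dc : differentiable c r by exact: (differentiableD dl (differentiable_cst y r)).
have Dc : 'D_1 c r = v.
  rewrite (deriveD (_ : derivable _ r 1) (derivable_cst y r 1)); last exact: diff_derivable.
  rewrite derive_cst addr0.
  by rewrite deriveE // (diffZl _ (ex_diff (f := @id R^o))) diff_val scale1r.
apply: DeriveDef; last by rewrite (@derive_comp _ _ _ c f r 1 dc df) Dc.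
by apply: diff_derivable; exact: (differentiable_comp dc df).
Qed.

Lemma mean_value0 (g dg : R^o -> R^o) (h : R) : 0 < h ->
  (forall r : R, 0 <= r <= h -> is_derive (r : R^o) (1 : R^o) g (dg r)) ->
  exists2 a, 0 < a < h & g h - g 0 = dg a * h.
Proof.
move=> h0 gP; have [r||a] := @MVT R g dg 0 h h0.
- by rewrite in_itv => /andP[/ltW r0 /ltW rh]; apply: gP; rewrite r0.
- apply: derivable_within_continuous => r; rewrite in_itv => rI.
  by apply: ex_derive; exact: gP.
by rewrite in_itv subr0; exists a.
Qed.

(** Two applications of the mean value theorem: along v to the increment of
    f in the direction w, then along w to the derivative obtained. *)
Lemma second_difference (V : normedModType R) (U : set V) (f : V -> R^o)
    (v w x : V) (h : R) : 0 < h -> Ck_on 2 U f ->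
  (forall a b, 0 <= a <= h -> 0 <= b <= h -> U (a *: v + (b *: w + x))) ->
  exists a b, [/\ 0 < a < h, 0 < b < h &
    f (h *: v + (h *: w + x)) - f (h *: v + x) - f (h *: w + x) + f x
    = h * h * 'D_w ('D_v f) (a *: v + (b *: w + x))].
Proof.
move=> h0 [df /(_ v)[dDf _]] inU.
have h0h : 0 <= h <= h by rewrite ltW //= lexx.
have z0h : (0 : R) <= 0 <= h by rewrite lexx ltW.
pose g (r : R^o) : R^o := f (r *: v + (h *: w + x)) - f (r *: v + x).
have dg (r : R) : 0 <= r <= h -> is_derive (r : R^o) (1 : R^o) g
    ('D_v f (r *: v + (h *: w + x)) - 'D_v f (r *: v + x)).
  move=> rh; apply: is_deriveB; apply: is_derive_line; apply: df.
    exact: inU.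
  by have := inU r 0 rh z0h; rewrite scale0r add0r.
have [a ah ga] := mean_value0 h0 dg.
pose k (r : R^o) : R^o := 'D_v f (r *: w + (a *: v + x)).
have dk (r : R) : 0 <= r <= h ->
    is_derive (r : R^o) (1 : R^o) k ('D_w ('D_v f) (r *: w + (a *: v + x))).
  move=> rh; apply: is_derive_line; apply: dDf; rewrite addrCA.
  by apply: inU => //; case/andP: ah => /ltW -> /ltW ->.
have [b bh kb] := mean_value0 h0 dk.
exists a, b; split=> //.
move: ga kb; rewrite /g /k !scale0r !add0r.
rewrite ![_ *: w + (a *: v + x)]addrCA => ga kb.
by rewrite -[LHS]addrA [- f _ + f _]addrC -[f x - _]opprB ga kb -mulrA mulrC.
Qed.

(** The second difference is symmetric in v and w, so h^2 times a value of
    each mixed derivative near x represents it; both mixed derivatives being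
    continuous, they agree at x. *)
Lemma derive_swap (V : normedModType R) (U : set V) (f : V -> R^o)
    (v w x : V) : open U -> U x -> Ck_on 2 U f ->
  'D_w ('D_v f) x = 'D_v ('D_w f) x.
Proof.
move=> oU Ux Cf; apply/eqP; rewrite -subr_eq0 -normr_le0; apply/ler_addgt0Pr.
move=> e e0; rewrite add0r.
have Dc (p q : V) : {for x, continuous ('D_p ('D_q f))} by exact: ((Cf.2 q).2 p x Ux).
have e20 : 0 < e / 2 by rewrite divr_gt0.
have n1 : nbhs x U by exact: open_nbhs_nbhs.
have n2 : \forall y \near x, `|'D_w ('D_v f) x - 'D_w ('D_v f) y| < e / 2.
  by exact: ((cvgrPdist_lt _ _).1 (Dc w v) _ e20).
have n3 : \forall y \near x, `|'D_v ('D_w f) x - 'D_v ('D_w f) y| < e / 2.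
  by exact: ((cvgrPdist_lt _ _).1 (Dc v w) _ e20).
have nU := filterI n1 (filterI n2 n3).
have [r /= r0 rU] := (nbhs_ballP _ _).1 (nU _ _).
pose c := `|v| + `|w| + 1.
have c0 : 0 < c by rewrite ltr_wpDl // addr_ge0.
pose h := r / c; have h0 : 0 < h by rewrite divr_gt0.
have inP a b (ha : 0 <= a <= h) (hb : 0 <= b <= h) :
    ball x r (a *: v + (b *: w + x)).
  move: ha hb => /andP[a0 ah] /andP[b0 bh].
  rewrite -ball_normE /= distrC addrA addrK (le_lt_trans (ler_normD _ _)) //.
  rewrite !normrZ !ger0_norm // (@le_lt_trans _ _ (h * (`|v| + `|w|))) //.
    by rewrite mulrDr lerD // ler_wpM2r.
  by rewrite /h mulrAC ltr_pdivrMr // ltr_pM2l // ltrDl.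
have [|a [b [ha hb E1]]] := second_difference (v := v) (w := w) (x := x) h0 Cf.
  by move=> a b ha hb; have [] := rU _ (inP a b ha hb).
have [|b' [a' [hb' ha' E2]]] := second_difference (v := w) (w := v) (x := x) h0 Cf.
  by move=> p q hp hq; rewrite addrCA; have [] := rU _ (inP q p hq hp).
have ltleW t : 0 < t < h -> 0 <= t <= h by case/andP => /ltW-> /ltW->.
have [_ [P1 _]] := rU _ (inP a b (ltleW _ ha) (ltleW _ hb)).
have [_ [_ P2]] := rU _ (inP a' b' (ltleW _ ha') (ltleW _ hb')).
have E : 'D_w ('D_v f) (a *: v + (b *: w + x)) = 'D_v ('D_w f) (a' *: v + (b' *: w + x)).
  apply: (mulfI (x := h * h)); first by rewrite mulf_neq0 ?gt_eqF.
  rewrite [a' *: v + _]addrCA; apply: etrans (esym E1) (etrans _ E2).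
  by rewrite [h *: w + (h *: v + x)]addrCA; congr (_ + _); rewrite addrAC.
rewrite (splitr e).
rewrite -(subrKA ('D_w ('D_v f) (a *: v + (b *: w + x)))).
apply: le_trans (ler_normD _ _) _; apply: lerD; apply: ltW; first exact: P1.
rewrite E distrC; exact: P2.
Qed.

End SmoothCalculus.

(** * Bump functions *)

Section Bump.
Context {R : realType}.

(** The whole family t^-m exp (- 1 / t) is needed: the derivative of each
    member is a combination of two others, so that one induction proves all of
    them smooth. *)
Definition flat (m : nat) (t : R^o) : R^o :=
  if 0 < t then t^-1 ^+ m * expR (- t^-1) else 0.

(** The exponential of 1 / t dominates (1 / t)^(m+2) / (m+2)!. The quadratic
    bound yields differentiability at 0, with derivative 0. *)
Lemma flat_bound m (t : R) : `|flat m t| <= m.+2`!%:R * t ^+ 2.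
Proof.
rewrite /flat; case: ifPn => [t0|_]; last first.
  by rewrite normr0 mulr_ge0 // sqr_ge0.
have x0 : 0 < t^-1 by rewrite invr_gt0.
rewrite ger0_norm; last by rewrite mulr_ge0 ?expR_ge0 // exprn_ge0 // ltW.
have F0 : 0 < m.+2`!%:R :> R by rewrite ltr0n fact_gt0.
have E : t^-1 ^+ m.+2 / m.+2`!%:R <= expR t^-1.
  by apply: le_trans (expR_ge1Dxn m.+1 (ltW x0)); rewrite lerDr.
rewrite expRN ler_pdivrMr ?expR_gt0 //.
rewrite ler_pdivrMr // in E.
apply: le_trans (_ : t ^+ 2 * (expR t^-1 * m.+2`!%:R) <= _); last first.
  by rewrite [leLHS](_ : _ = m.+2`!%:R * t ^+ 2 * expR t^-1) //; ring.
apply: le_trans (ler_wpM2l (sqr_ge0 t) E).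
by rewrite -[m.+2]addn2 exprD mulrCA -exprMn divff ?gt_eqF // expr1n mulr1.
Qed.

Lemma is_derive_flat m (t : R^o) :
  is_derive t (1 : R^o) (flat m) (flat m.+2 t - m%:R * flat m.+1 t).
Proof.
have [t0|t0|->] := ltgtP t 0.
- have E : \forall y \near t, (cst 0 : R^o -> R^o) y = flat m y.
    near=> y; rewrite /flat ltNge ltW //; near: y.
    exact: lt_nbhsl.
  apply: near_eq_is_derive E _.
  by rewrite /flat !ltNge !(ltW t0) /= mulr0 subr0; exact: is_derive_cst.
- have E : \forall y \near t, y^-1 ^+ m * expR (- y^-1) = flat m y.
    near=> y; rewrite /flat ifT //; near: y; exact: lt_nbhsr.
  apply: near_eq_is_derive E _; rewrite /flat t0.
  pose i (y : R^o) : R^o := y^-1.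
  have Di : is_derive t (1 : R^o) i (- t^-1 ^+ 2).
    apply: DeriveDef; first by apply: derivableV => //; rewrite gt_eqF.
    by rewrite deriveV ?gt_eqF // derive_id /GRing.scale /= mulr1 exprVn.
  have De : is_derive t (1 : R^o) (expR \o (- i)) (expR (- t^-1) * - - t^-1 ^+ 2).
    exact: is_derive1_comp.
  rewrite (_ : (fun _ => _) = i ^+ m * (expR \o (- i))); last first.
    by rewrite exprfctE.
  apply: is_derive_eq; rewrite /i /= fctE /= /GRing.scale /=.
  by case: m => [|m] /=; rewrite ?exprS; ring.
- have F0 k (z : R) : z = 0 -> flat k z = 0 by move=> ->; rewrite /flat ltxx.
  have d0 : h^-1 *: ((flat m \o shift 0) (h *: (1 : R^o)) - flat m 0) @[h --> 0^']
      --> (0 : R^o).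
    rewrite F0 //=.
    apply/cvgrPdist_le => e e0; near=> h.
    have h0 : h != 0 by near: h; exact: nbhs_dnbhs_neq.
    rewrite sub0r normrN subr0 addr0 [_%:A]mulr1 normrZ normfV.
    rewrite ler_pdivrMl ?normr_gt0 // (le_trans (flat_bound _ _)) //.
    rewrite -[h ^+ 2]real_normK ?num_real // expr2 mulrA [leLHS]mulrC ler_wpM2l //.
    rewrite -ler_pdivlMl ?ltr0n ?fact_gt0 //; near: h.
    apply: dnbhs0_le; rewrite mulr_gt0 // invr_gt0 ltr0n fact_gt0 //.
  rewrite !F0 // mulr0 subr0; apply: DeriveDef; last exact: cvg_lim.
  by apply/cvg_ex; exists 0.
Unshelve. all: by end_near. Qed.

Lemma differentiable_flat m (t : R^o) : differentiable (flat m) t.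
Proof. by apply/derivable1_diffP; apply: ex_derive; exact: is_derive_flat. Qed.

Lemma Ck_on_flat (V : normedModType R) k (U : set V) (u : V -> R^o) m :
  open U -> Ck_on k U u -> Ck_on k U (flat m \o u).
Proof.
move=> oU; elim: k m => [|k IH] m Cu.
  move=> x Ux; apply: continuous_comp; first exact: Cu.
  exact: (differentiable_continuous (differentiable_flat m (u x))).
have [du Du] := Cu; split=> [x Ux|v].
  exact: (differentiable_comp (du x Ux) (differentiable_flat m (u x))).
apply: (Ck_on_eq oU) (_ : _ _ _ (fun x => 'D_v u x *
    ((flat m.+2 \o u) x + - m%:R * (flat m.+1 \o u) x) : R^o)) => [x Ux|].
  rewrite (derive_comp _ (du x Ux) (differentiable_flat m (u x))).
  rewrite deriveE; last exact: differentiable_flat.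
  have -> : 'D_v u x = 'D_v u x *: (1 : R^o) by rewrite [RHS]mulr1.
  rewrite linearZ -deriveE /=; last exact: differentiable_flat.
  by have [_ ->] := is_derive_flat m (u x); rewrite mulNr [_%:A]mulr1.
have Cu' := Ck_on_pred Cu.
apply: Ck_on_mul => //; first exact: Du.
apply: Ck_on_add => //; first exact: IH.
by apply: Ck_on_mul => //; [exact: Ck_on_cst|exact: IH].
Qed.

(** The squared Euclidean distance is used because the norm of row vectors,
    a maximum, is not differentiable. *)
Definition ball_bump d (c : 'rV[R]_d) (r : R) (x : 'rV[R]_d) : R^o :=
  flat 0 (r ^+ 2 - \sum_i (x 0 i - c 0 i) ^+ 2).

Lemma smooth_ball_bump d (c : 'rV[R]_d) r U : open U -> smooth_on U (ball_bump c r).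
Proof.
move=> oU k; apply: (Ck_on_flat 0 oU); apply: Ck_on_add => //.
  exact: Ck_on_cst.
have -> : (fun x : 'rV[R]_d => - \sum_i (x 0 i - c 0 i) ^+ 2) =
    fun x => \sum_i (-1) * ((x 0 i - c 0 i) * (x 0 i - c 0 i)) :> R^o.
  apply/funext => x; rewrite -sumrN; apply: eq_bigr => i _.
  by rewrite mulN1r expr2.
apply: Ck_on_sum => // i.
have C : Ck_on k U (fun x : 'rV[R]_d => x 0 i - c 0 i : R^o).
  apply: Ck_on_add => //; last exact: Ck_on_cst.
  exact: ((Ck_on_mxP k _ oU).1 (Ck_on_id k U) 0 i).
by apply: Ck_on_mul => //; [exact: Ck_on_cst|exact: Ck_on_mul].
Qed.

Lemma ball_bump_center d (c : 'rV[R]_d) r : 0 < r -> 0 < ball_bump c r c.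
Proof.
move=> r0; rewrite /ball_bump big1 => [|i _]; last by rewrite subrr expr0n.
by rewrite /flat subr0 exprn_gt0 // expr0 mul1r expR_gt0.
Qed.

Lemma ball_bump_support d (c x : 'rV[R]_d) r :
  0 <= r -> ball_bump c r x != 0 -> `|x - c| <= r.
Proof.
move=> r0; rewrite /ball_bump /flat; case: ifP; last by rewrite eqxx.
rewrite subr_gt0 => /ltW sr _.
rewrite [leLHS]/Num.Def.normr/= mx_normrE; apply: bigmax_le => // -[i j] _ /=.
rewrite ord1 !mxE -(@ler_pXn2r _ 2) ?nnegrE // real_normK ?num_real //.
apply: le_trans sr; rewrite (bigD1 j) //= lerDl.
by apply: sumr_ge0 => l _; exact: sqr_ge0.
Qed.

End Bump.

(** * Changes of charts and smooth fields *)

Section ChangeOfChart.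
Context {R : realType} {d : nat} {M : manifold R d}.
Implicit Types (e : chart R d M) (p q : M) (x : 'rV[R]_d).

Definition overlap e e' : set 'rV[R]_d := ccod e `&` cfrom e @^-1` cdom e'.

Definition transition e e' : 'rV[R]_d -> 'rV[R]_d := cto e' \o cfrom e.

Lemma open_chart_preimage e (U : set M) :
  open U -> open (ccod e `&` cfrom e @^-1` U).
Proof.
move=> oU; rewrite openE => x [ex Ux]; rewrite /interior.
apply: filterI; first by apply: open_nbhs_nbhs; split=> //; exact: ccod_open.
by apply: (cfrom_continuous ex); apply: open_nbhs_nbhs.
Qed.

Lemma overlap_open e e' : open (overlap e e').
Proof. by apply: open_chart_preimage; exact: cdom_open. Qed.

Lemma transition_overlap e e' x : overlap e e' x -> overlap e' e (transition e e' x).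
Proof.
move=> [ex ex']; split; first exact: cto_in.
by rewrite /= ctoK //; exact: cfrom_in.
Qed.

Lemma overlap_cto e e' q : cdom e q -> cdom e' q -> overlap e e' (cto e q).
Proof. by move=> eq eq'; split; [exact: cto_in|rewrite /= ctoK]. Qed.

Lemma transition_comp e e' e'' x : overlap e e' x ->
  transition e' e'' (transition e e' x) = transition e e'' x.
Proof. by move=> [ex ex']; rewrite /transition /= ctoK. Qed.

Lemma transition_id e x : ccod e x -> transition e e x = x.
Proof. by move=> ex; rewrite /transition /= cfromK. Qed.

Lemma smooth_transition e e' : atlas M e -> atlas M e' ->
  smooth_on (overlap e e') (transition e e').
Proof. exact: atlas_compat. Qed.

Lemma differentiable_transition e e' x : atlas M e -> atlas M e' ->
  overlap e e' x -> differentiable (transition e e') x.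
Proof. by move=> ea e'a ox; case: (smooth_transition ea e'a 1) => /(_ x ox). Qed.

Lemma row_jacobian d1 d2 (f : 'rV[R]_d1 -> 'rV[R]_d2) (x : 'rV[R]_d1) i :
  differentiable f x -> row i (jacobian f x) = 'D_(delta_mx 0 i) f x.
Proof. by move=> df; rewrite deriveEjacobian // -rowE. Qed.

Lemma jacobian_comp d1 d2 d3 (f : 'rV[R]_d1 -> 'rV[R]_d2)
    (g : 'rV[R]_d2 -> 'rV[R]_d3) (x : 'rV[R]_d1) :
  differentiable f x -> differentiable g (f x) ->
  jacobian (g \o f) x = jacobian f x *m jacobian g (f x).
Proof.
move=> df dg; have dgf : differentiable (g \o f) x by exact: differentiable_comp.
apply/row_matrixP => i; rewrite row_mul (row_jacobian _ dgf) (row_jacobian _ df).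
by rewrite -(deriveEjacobian _ dg); exact: derive_comp.
Qed.

Lemma eq_jacobian d1 d2 (U : set 'rV[R]_d1) (f g : 'rV[R]_d1 -> 'rV[R]_d2)
    (x : 'rV[R]_d1) : open U -> U x -> (forall y, U y -> f y = g y) ->
  differentiable g x -> jacobian f x = jacobian g x.
Proof.
move=> oU Ux fg dg.
have nU (h k : 'rV[R]_d1 -> 'rV[R]_d2) : (forall y, U y -> h y = k y) ->
    \forall y \near x, h y = k y.
  by move=> hk; near=> y; apply: hk; near: y; exact: open_nbhs_nbhs.
have df : differentiable f x.
  by apply: (near_eq_differentiable _ dg); apply: nU => y /fg.
apply/row_matrixP => i.
apply: etrans (row_jacobian i df) (etrans _ (esym (row_jacobian i dg))).
by apply: near_eq_derive; exact: nU.
Unshelve. all: by end_near. Qed.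

Lemma jacobian_transition e e' e'' x :
  atlas M e -> atlas M e' -> atlas M e'' -> overlap e e' x -> overlap e e'' x ->
  jacobian (transition e e'') x =
  jacobian (transition e e') x *m jacobian (transition e' e'') (transition e e' x).
Proof.
move=> ea e'a e''a oe' oe''.
have oe'e'' : overlap e' e'' (transition e e' x).
  have [ex ex'] := oe'; split; first exact: cto_in.
  by rewrite /= ctoK //; case: oe''.
have d1 := differentiable_transition ea e'a oe'.
have d2 := differentiable_transition e'a e''a oe'e''.
have <- := jacobian_comp d1 d2.
apply: (eq_jacobian (@overlap_open e e')) => //.
  by move=> y oy; rewrite /= transition_comp.
exact: differentiable_comp.
Qed.

Lemma jacobian_transition_id e x : ccod e x -> jacobian (transition e e) x = 1%:M.
Proof.
move=> ex; rewrite (@eq_jacobian _ _ (ccod e) _ id x (ccod_open (c := e))) //.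
  by apply/row_matrixP => i; rewrite row_jacobian // derive_id row1.
by move=> y; exact: transition_id.
Qed.

(** The chain rule, through the preferred chart at q. *)
Lemma frame_transition e e' q : atlas M e -> atlas M e' -> cdom e q -> cdom e' q ->
  frame e' q = frame e q *m jacobian (transition e e') (cto e q).
Proof.
move=> ea e'a eq e'q; have q0 := chart_at_dom q; have a0 := chart_at_atlas q.
have te : transition (chart_at q) e (cto (chart_at q) q) = cto e q.
  by rewrite /transition /= ctoK.
have := jacobian_transition a0 ea e'a (overlap_cto q0 eq) (overlap_cto q0 e'q).
by rewrite te.
Qed.

Lemma frame_self p : frame (chart_at p) p = 1%:M.
Proof. by apply: jacobian_transition_id; apply: cto_in; exact: chart_at_dom. Qed.

Lemma frame_unit e q : atlas M e -> cdom e q -> frame e q \in unitmx.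
Proof.
move=> ea eq.
have F := frame_transition ea (chart_at_atlas q) eq (chart_at_dom q).
have F1 : 1%:M = frame e q *m jacobian (transition e (chart_at q)) (cto e q).
  by transitivity (frame (chart_at q) q); [exact: esym (frame_self q)|exact: F].
exact: (proj1 (mulmx1_unit (esym F1))).
Qed.

Lemma frame_ratio e e' q : atlas M e -> atlas M e' -> cdom e q -> cdom e' q ->
  invmx (frame e q) *m frame e' q = jacobian (transition e e') (cto e q).
Proof.
move=> ea e'a eq e'q; rewrite (frame_transition ea e'a eq e'q).
exact: (mulKmx (frame_unit ea eq)).
Qed.

Lemma vf_rep_cto e (X : vfield M) p : cdom e p ->
  vf_rep e X (cto e p) = X p *m frame e p.
Proof. by move=> ep; rewrite /vf_rep ctoK. Qed.

Lemma vf_rep_self (X : vfield M) p :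
  vf_rep (chart_at p) X (cto (chart_at p) p) = X p.
Proof. by rewrite vf_rep_cto ?frame_self ?mulmx1 //; exact: chart_at_dom. Qed.

End ChangeOfChart.

Arguments overlap_open {R d M} e e'.

Section SmoothFields.
Context {R : realType} {d : nat} {M : manifold R d}.
Implicit Types (e : chart R d M) (p q : M) (x : 'rV[R]_d).
Implicit Types (f : M -> R) (X Y Z : vfield M).

Lemma smooth_vfP X :
  smooth_vf X <-> forall e, atlas M e -> smooth_on (ccod e) (vf_rep e X).
Proof.
by split=> sX e ea k; apply: Ck_onS (sX e ea k) => x //; case.
Qed.

Lemma smooth_fun_differentiable e f x : atlas M e -> smooth_fun f -> ccod e x ->
  differentiable (f \o cfrom e : 'rV[R]_d -> R^o) x.
Proof. by move=> ea sf ex; case: (sf e ea 1) => /(_ x ex). Qed.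

(** The chain rule for the change from the preferred chart at p to e. *)
Lemma vf_der_chart e X f p : atlas M e -> smooth_fun f -> cdom e p ->
  vf_der X f p =
  'D_(vf_rep e X (cto e p)) (f \o cfrom e : 'rV[R]_d -> R^o) (cto e p).
Proof.
move=> ea sf ep; set e0 := chart_at p.
have a0 : atlas M e0 by exact: chart_at_atlas.
have p0 : cdom e0 p by exact: chart_at_dom.
have o0 : overlap e0 e (cto e0 p) by exact: overlap_cto.
have tp : transition e0 e (cto e0 p) = cto e p by rewrite /transition /= ctoK.
have Dt : differentiable (transition e0 e) (cto e0 p) by exact: differentiable_transition.
rewrite /vf_der vf_rep_cto // /frame -/e0 -/(transition e0 e) -deriveEjacobian //.
rewrite -tp -(derive_comp _ Dt); last first.
  by apply: smooth_fun_differentiable => //; rewrite tp; exact: cto_in.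
apply: near_eq_derive; near=> x.
suff [ex ex'] : overlap e0 e x by rewrite /transition /= ctoK.
by near: x; apply: open_nbhs_nbhs; split=> //; exact: overlap_open.
Unshelve. all: by end_near. Qed.

Lemma smooth_fun_cst (c : R) : smooth_fun (fun _ : M => c).
Proof. by move=> e ea k; exact: Ck_on_cst. Qed.

Lemma smooth_fun_add f f' : smooth_fun f -> smooth_fun f' ->
  smooth_fun (fun p => f p + f' p).
Proof.
by move=> sf sf' e ea k; exact: (Ck_on_add (ccod_open (c := e)) (sf e ea k) (sf' e ea k)).
Qed.

Lemma smooth_fun_mul f f' : smooth_fun f -> smooth_fun f' ->
  smooth_fun (fun p => f p * f' p).
Proof.
by move=> sf sf' e ea k; exact: (Ck_on_mul (ccod_open (c := e)) (sf e ea k) (sf' e ea k)).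
Qed.

Lemma smooth_vf_add X Y : smooth_vf X -> smooth_vf Y ->
  smooth_vf (fun p => X p + Y p).
Proof.
move=> /smooth_vfP sX /smooth_vfP sY; apply/smooth_vfP => e ea k.
rewrite (_ : vf_rep e _ = fun x => vf_rep e X x + vf_rep e Y x).
  exact: (Ck_on_add (ccod_open (c := e)) (sX e ea k) (sY e ea k)).
by apply/funext => x; rewrite /vf_rep mulmxDl.
Qed.

Lemma smooth_vf_scale f X : smooth_fun f -> smooth_vf X ->
  smooth_vf (fun p => f p *: X p).
Proof.
move=> sf /smooth_vfP sX; apply/smooth_vfP => e ea k.
rewrite (_ : vf_rep e _ = fun x => (f \o cfrom e) x *: vf_rep e X x).
  exact: (Ck_on_scale (ccod_open (c := e)) (sf e ea k) (sX e ea k)).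
by apply/funext => x; rewrite /vf_rep scalemxAl.
Qed.

Lemma smooth_app11 A X : smooth_tensor11 A -> smooth_vf X -> smooth_vf (app11 A X).
Proof.
move=> sA /smooth_vfP sX; apply/smooth_vfP => e ea k.
apply: (Ck_on_eq (ccod_open (c := e)) _ (Ck_on_mulmx (ccod_open (c := e))
  (sX e ea k) (sA e ea k))) => x ex.
rewrite /vf_rep /tensor11_rep /app11 !mulmxA mulmxK //.
by apply: frame_unit => //; exact: cfrom_in.
Qed.

Lemma smooth_app1 eta X : smooth_form1 eta -> smooth_vf X -> smooth_fun (app1 eta X).
Proof.
move=> sA /smooth_vfP sX e ea k.
have C := (Ck_on_mxP k _ (ccod_open (c := e))).1
  (Ck_on_mulmx (ccod_open (c := e)) (sX e ea k) (sA e ea k)) 0 0.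
apply: (Ck_on_eq (ccod_open (c := e)) _ C) => x ex.
rewrite /vf_rep /form1_rep /app1 !mulmxA mulmxK //.
by apply: frame_unit => //; exact: cfrom_in.
Qed.

Lemma smooth_app2 g X Y : smooth_tensor02 g -> smooth_vf X -> smooth_vf Y ->
  smooth_fun (app2 g X Y).
Proof.
move=> sA /smooth_vfP sX /smooth_vfP sY e ea k.
have o := ccod_open (c := e).
have C := (Ck_on_mxP k _ o).1 (Ck_on_mulmx o
  (Ck_on_mulmx o (sX e ea k) (sA e ea k)) (Ck_on_tr o (sY e ea k))) 0 0.
apply: (Ck_on_eq o _ C) => x ex.
have u : frame e (cfrom e x) \in unitmx.
  by apply: frame_unit => //; exact: cfrom_in.
rewrite /vf_rep /tensor02_rep /app2 /papp !mulmxA mulmxK // trmx_mul !mulmxA.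
by rewrite trmx_inv mulmxKV // unitmx_tr.
Qed.

Lemma smooth_vf_der X f : smooth_vf X -> smooth_fun f -> smooth_fun (vf_der X f).
Proof.
move=> /smooth_vfP sX sf e ea k; have o := ccod_open (c := e).
apply: (Ck_on_eq o _ (Ck_on_derive o (sX e ea k) (sf e ea k.+1))) => x ex.
by rewrite /= (@vf_der_chart e) ?cfromK //; exact: cfrom_in.
Qed.

End SmoothFields.

(** * Extension of tangent vectors, brackets and closed forms *)

Section Cutoff.
Context {R : realType} {d : nat} {M : manifold R d}.
Implicit Types (e : chart R d M) (p q : M) (x : 'rV[R]_d).
Implicit Types (f : M -> R) (X Y Z : vfield M).

(** Extension by zero: near a point outside the chart domain of e the
    function vanishes identically, because K is closed. *)
Lemma Ck_on_glue (W : normedModType R) k e e' (K : set M) (F : 'rV[R]_d -> W) :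
  closed K -> K `<=` cdom e -> Ck_on k (overlap e' e) F ->
  (forall x, ccod e' x -> ~ K (cfrom e' x) -> F x = 0) ->
  Ck_on k (ccod e') F.
Proof.
move=> cK Ke CF F0; apply: Ck_on_local => x ex.
have [Kx|nKx] := pselect (K (cfrom e' x)).
  exists (overlap e' e); first by split; [exact: overlap_open|split=> //; exact: Ke].
  by exists F.
exists (ccod e' `&` cfrom e' @^-1` ~` K).
  by split=> //; apply: open_chart_preimage; exact: closed_openC.
exists (fun=> 0); first exact: Ck_on_cst.
by move=> y [ey nKy]; exact: F0.
Qed.

(** A bump function read in a chart and extended by zero. Its support lies
    in the image K of a closed ball, which is compact, hence closed since the
    manifold is Hausdorff. *)
Lemma cutoff_function p : exists2 chi : M -> R, smooth_fun chi /\ chi p = 1 &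
  exists2 K, closed K /\ K `<=` cdom (chart_at p) & forall q, ~ K q -> chi q = 0.
Proof.
set e := chart_at p; set x0 := cto e p.
have ep : cdom e p by exact: chart_at_dom.
have ea : atlas M e by exact: chart_at_atlas.
have /nbhs_ballP[r /= r0 rE] : nbhs x0 (ccod e).
  by apply: open_nbhs_nbhs; split; [exact: ccod_open|exact: cto_in].
pose s := r / 2; have s0 : 0 < s by rewrite divr_gt0.
pose B := [set x : 'rV[R]_d | `|x - x0| <= s].
have BE : B `<=` ccod e.
  move=> x Bx; apply: rE; rewrite -ball_normE /= distrC (le_lt_trans Bx) //.
  by rewrite /s ltr_pdivrMr // ltr_pMr // ltr1n.
have cB : compact B.
  apply: bounded_closed_compact.
    exists (s + `|x0|); split=> [|t lt x Bx]; first exact: num_real.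
    rewrite /= -(subrK x0 x); apply: le_trans (ler_normD _ _) _.
    by apply: le_trans (ltW lt); rewrite lerD.
  rewrite (_ : B = closed_ball x0 s); first exact: closed_ball_closed.
  rewrite closed_ballE //; apply/seteqP; rewrite /closed_ball_ /B.
  by split=> x /=; rewrite distrC.
pose K := cfrom e @` B.
have cK : closed K.
  apply: compact_closed; first exact: manifold_hausdorff.
  apply: continuous_compact => //; apply: continuous_in_subspaceT => x.
  by rewrite inE => Bx; apply: cfrom_continuous; exact: BE.
have Ke : K `<=` cdom e by move=> _ [x Bx <-]; apply: cfrom_in; exact: BE.
pose chi q := if `[< cdom e q >] then (ball_bump x0 s x0)^-1 * ball_bump x0 s (cto e q) else 0.
have chi0 q : ~ K q -> chi q = 0.
  move=> nK; rewrite /chi; case: asboolP => // eq.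
  have [->|nz] := eqVneq (ball_bump x0 s (cto e q)) 0; first by rewrite mulr0.
  case: nK; exists (cto e q); last by rewrite ctoK.
  by apply: ball_bump_support nz; exact: ltW.
exists chi; last by exists K.
split; last first.
  by rewrite /chi; case: asboolP => // _; rewrite mulVf // gt_eqF // ball_bump_center.
move=> e' e'a k; apply: (Ck_on_glue cK Ke); last by move=> x _; exact: chi0.
have o := overlap_open e' e.
apply: (Ck_on_eq o) (Ck_on_mul o (Ck_on_cst k _ (ball_bump x0 s x0)^-1)
  (Ck_on_comp o (@transition_overlap _ _ _ e' e) (smooth_transition e'a ea k)
     (smooth_ball_bump x0 s (overlap_open e e') k))) => x [ex ex'].
by rewrite /= /chi; case: asboolP.
Qed.

(** Identities between smooth fields thus become identities between tangent
    vectors. The field has constant components v in the chart, times a cutoff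
    function. *)
Lemma vf_through p (v : 'rV[R]_d) : exists2 X, smooth_vf X & X p = v.
Proof.
have [chi [schi chip] [K [cK Ke] chi0]] := cutoff_function p.
set e := chart_at p in Ke.
have ep : cdom e p by exact: chart_at_dom.
have ea : atlas M e by exact: chart_at_atlas.
exists (fun q => chi q *: (v *m invmx (frame e q))); last first.
  by rewrite chip scale1r /e frame_self invmx1 mulmx1.
apply/smooth_vfP => e' e'a k; apply: (Ck_on_glue cK Ke); last first.
  by move=> x ex nK; rewrite /vf_rep chi0 // scale0r mul0mx.
have o := overlap_open e' e; have o' := overlap_open e e'.
have Cchi : Ck_on k (overlap e' e) (chi \o cfrom e' : _ -> R^o).
  by apply: Ck_onS (schi e' e'a k) => x [].
apply: (Ck_on_eq o) (Ck_on_scale o Cchi (Ck_on_mulmx o (Ck_on_cst k _ v)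
  (Ck_on_comp_mx o o' (@transition_overlap _ _ _ e' e) (smooth_transition e'a ea k)
     (Ck_on_jacobian o' (smooth_transition ea e'a k.+1))))) => x [ex ex'].
transitivity (chi (cfrom e' x) *:
    (v *m (invmx (frame e (cfrom e' x)) *m frame e' (cfrom e' x)))).
  by rewrite /vf_rep mulmxA -scalemxAl.
congr (_ *: (_ *m _)); exact: (frame_ratio ea e'a ex' (cfrom_in ex)).
Qed.

(** Tested on the coordinate functions at p times a cutoff function, whose
    derivatives along v are the components of v. *)
Lemma vector_separated p (v : 'rV[R]_d) :
  (forall f, smooth_fun f ->
     'D_v (f \o cfrom (chart_at p) : 'rV[R]_d -> R^o) (cto (chart_at p) p) = 0) ->
  v = 0.
Proof.
have [chi [schi chip] [K [cK Ke] chi0]] := cutoff_function p.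
set e := chart_at p; set x0 := cto e p => v0.
have ep : cdom e p by exact: chart_at_dom.
have ea : atlas M e by exact: chart_at_atlas.
apply/rowP => j; rewrite mxE.
pose f q := chi q * (cto e q 0 j - x0 0 j).
have Cy k (U : set 'rV[R]_d) (u : 'rV[R]_d -> 'rV[R]_d) : open U -> Ck_on k U u ->
    Ck_on k U (fun x => u x 0 j - x0 0 j : R^o).
  move=> oU Cu; apply: Ck_on_add => //; last exact: Ck_on_cst.
  exact: ((Ck_on_mxP k _ oU).1 Cu 0 j).
have sf : smooth_fun f.
  move=> e' e'a k; apply: (Ck_on_glue cK Ke); last first.
    by move=> x _ nK; rewrite /= /f chi0 // mul0r.
  have o := overlap_open e' e.
  have Cchi : Ck_on k (overlap e' e) (chi \o cfrom e' : _ -> R^o).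
    by apply: Ck_onS (schi e' e'a k) => x [].
  apply: (Ck_on_eq o) (Ck_on_mul o Cchi (Cy k _ _ o (smooth_transition e'a ea k))).
  by move=> x _.
have x0e : ccod e x0 by exact: cto_in.
have Dchi := smooth_fun_differentiable ea schi x0e.
have Dy : differentiable (fun x => x 0 j - x0 0 j : R^o) x0.
  by case: (Cy 1 (ccod e) id (ccod_open (c := e)) (Ck_on_id _ _)) => /(_ x0 x0e).
have := v0 f sf.
rewrite (@near_eq_derive _ _ _ _
   ((chi \o cfrom e : 'rV[R]_d -> R^o) * (fun x => x 0 j - x0 0 j)) x0 v); last first.
  near=> x; rewrite /= /f fctE /= cfromK //; near: x.
  by apply: open_nbhs_nbhs; split=> //; exact: ccod_open.
rewrite deriveM; try exact: diff_derivable.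
rewrite subrr scale0r addr0 /= ctoK // chip scale1r.
rewrite (@deriveB _ _ _ (fun x => x 0 j) (cst (x0 0 j))); last 2 first.
- by apply: diff_derivable; exact: differentiable_coord.
- exact: derivable_cst.
rewrite derive_cst subr0.
have := @derive_mx _ _ 1 d id x0 v (@derivable_id _ _ x0 v).
by rewrite derive_id => /matrixP/(_ 0 j); rewrite mxE => <-.
Unshelve. all: by end_near. Qed.

End Cutoff.

Section Bracket.
Context {R : realType} {d : nat} {M : manifold R d}.
Implicit Types (p : M) (f : M -> R) (X Y Z : vfield M).

(** The product rule for the sum of w_i times the partial derivatives of f:
    either w or f is differentiated. *)
Lemma derive_derive (U : set 'rV[R]_d) (w : 'rV[R]_d -> 'rV[R]_d)
    (f : 'rV[R]_d -> R^o) (x v : 'rV[R]_d) : open U -> U x ->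
  Ck_on 1 U w -> Ck_on 2 U f ->
  'D_v (fun y => 'D_(w y) f y) x = 'D_('D_v w x) f x + 'D_v ('D_(w x) f) x.
Proof.
move=> oU Ux [dw _] [df Df].
pose D i : 'rV[R]_d -> R^o := 'D_(delta_mx 0 i) f.
have dD i : differentiable (D i) x by case: (Df (delta_mx 0 i)) => /(_ x Ux).
have nU (h k : 'rV[R]_d -> R^o) : (forall y, U y -> h y = k y) ->
    \forall y \near x, h y = k y.
  by move=> hk; near=> y; apply: hk; near: y; exact: open_nbhs_nbhs.
have E1 : 'D_v (fun y => 'D_(w y) f y) x =
    'D_v (\sum_i (fun y => w y 0 i : R^o) * D i) x.
  apply: near_eq_derive; apply: nU => y Uy; rewrite fct_sumE derive_delta; last exact: df.
  by apply: eq_bigr.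
have E2 : 'D_v ('D_(w x) f) x = 'D_v (\sum_i (w x 0 i) \*: D i) x.
  apply: near_eq_derive; apply: nU => y Uy; rewrite fct_sumE derive_delta; last exact: df.
  by apply: eq_bigr.
have dwi i : derivable (fun y => w y 0 i : R^o) x v.
  apply: diff_derivable; exact: ((differentiable_mxP w x).1 (dw x Ux) 0 i).
have dDi i : derivable (D i) x v by exact: diff_derivable.
rewrite E1 E2 (derive_sum (fun i => derivableM (dwi i) (dDi i))).
rewrite (derive_sum (fun i => derivableZ (k := w x 0 i) (dDi i))).
rewrite derive_delta; last exact: df.
rewrite -big_split; apply: eq_bigr => i _ /=.
rewrite (deriveM (dwi i) (dDi i)) (deriveZ _ (dDi i)) addrC; congr (_ + _).
suff -> : ('D_v w x) 0 i = 'D_v (fun y => w y 0 i) x by exact: mulrC.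
by rewrite derive_mx ?mxE //; apply: diff_derivable; exact: dw.
Unshelve. all: by end_near. Qed.

(** The terms with first derivatives of X and Y form the bracket; those with
    second derivatives of f cancel by symmetry. *)
Lemma vf_der_bracket X Y f p : smooth_vf X -> smooth_vf Y -> smooth_fun f ->
  vf_der (lie_bracket X Y) f p = vf_der X (vf_der Y f) p - vf_der Y (vf_der X f) p.
Proof.
move=> sX sY sf; set e := chart_at p; set x0 := cto e p.
have ep : cdom e p by exact: chart_at_dom.
have ea : atlas M e by exact: chart_at_atlas.
have o := ccod_open (c := e).
have x0e : ccod e x0 by exact: cto_in.
pose F : 'rV[R]_d -> R^o := f \o cfrom e.
have CF k : Ck_on k (ccod e) F by exact: sf.
have dF : differentiable F x0 by case: (CF 1) => /(_ x0 x0e).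
have E Z Z' : smooth_vf Z' -> vf_der Z (vf_der Z' f) p =
    'D_('D_(Z p) (vf_rep e Z') x0) F x0 + 'D_(Z p) ('D_(Z' p) F) x0.
  move=> sZ'; rewrite -[in RHS](vf_rep_self Z' p) -/e -/x0.
  rewrite -(derive_derive (Z p) o x0e _ (CF 2)); last first.
    by have /smooth_vfP := sZ'; apply.
  rewrite /vf_der -/e -/x0; apply: near_eq_derive; near=> x.
  have ex : ccod e x by near: x; apply: open_nbhs_nbhs; split.
  by rewrite /= -/(vf_der _ _ _) (@vf_der_chart _ _ _ e) ?cfromK //; exact: cfrom_in.
have B : vf_der (lie_bracket X Y) f p =
    'D_('D_(X p) (vf_rep e Y) x0) F x0 - 'D_('D_(Y p) (vf_rep e X) x0) F x0.
  exact: (derive_dirB _ _ dF).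
have G (a b c b' : R) : b = b' -> a - c = a + b - (c + b') by move=> ->; ring.
rewrite (E X Y sY) (E Y X sX) B.
exact: (G _ _ _ _ (derive_swap (Y p) (X p) o x0e (CF 2))).
Unshelve. all: by end_near. Qed.

Lemma vf_der_addl X Y f p : smooth_fun f ->
  vf_der (fun q => X q + Y q) f p = vf_der X f p + vf_der Y f p.
Proof.
move=> sf; apply: derive_dirD; apply: smooth_fun_differentiable => //.
  exact: chart_at_atlas.
by apply: cto_in; exact: chart_at_dom.
Qed.

Lemma smooth_fun_sub f f' : smooth_fun f -> smooth_fun f' ->
  smooth_fun (fun p => f p - f' p).
Proof.
move=> sf sf'; have := smooth_fun_add sf (smooth_fun_mul (smooth_fun_cst (-1)) sf').
by congr smooth_fun; apply/funext => p; rewrite mulN1r.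
Qed.

Lemma vf_der_sub X f f' p : smooth_fun f -> smooth_fun f' ->
  vf_der X (fun q => f q - f' q) p = vf_der X f p - vf_der X f' p.
Proof.
move=> sf sf'; have x0e := cto_in (chart_at_dom p); have ea := chart_at_atlas p.
have df := smooth_fun_differentiable ea sf x0e.
have df' := smooth_fun_differentiable ea sf' x0e.
by apply: deriveB; apply: diff_derivable.
Qed.

Lemma vf_der_scale X f (c : R) p : smooth_fun f ->
  vf_der X (fun q => c * f q) p = c * vf_der X f p.
Proof.
move=> sf; have df := smooth_fun_differentiable (chart_at_atlas p) sf
  (cto_in (chart_at_dom p)).
by apply: (@deriveZ _ _ _ (f \o cfrom (chart_at p) : _ -> R^o)); apply: diff_derivable.
Qed.

Lemma vf_der_cst X (c : R) p : vf_der X (fun=> c) p = 0.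
Proof. exact: derive_cst. Qed.

(** For a torsion-free connection this follows from the smoothness of
    nabla X Y, without computing brackets in an arbitrary chart. *)
Definition smooth_brackets :=
  forall X Y : vfield M, smooth_vf X -> smooth_vf Y -> smooth_vf (lie_bracket X Y).

(** The sum acts on functions as a cyclic sum of iterated commutators of
    derivations, which vanishes identically, and a tangent vector is determined
    by its action on functions. *)
Lemma jacobi_identity X Y Z p : smooth_brackets ->
  smooth_vf X -> smooth_vf Y -> smooth_vf Z ->
  lie_bracket (lie_bracket X Y) Z p + lie_bracket (lie_bracket Y Z) X p
  + lie_bracket (lie_bracket Z X) Y p = 0.
Proof.
move=> sB sX sY sZ; apply: (@vector_separated _ _ _ p) => f sf.
have E U V W : smooth_vf U -> smooth_vf V -> smooth_vf W ->
    vf_der (lie_bracket (lie_bracket U V) W) f p =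
    vf_der U (vf_der V (vf_der W f)) p - vf_der V (vf_der U (vf_der W f)) p
    - (vf_der W (vf_der U (vf_der V f)) p - vf_der W (vf_der V (vf_der U f)) p).
  move=> sU sV sW; rewrite vf_der_bracket //; last exact: sB.
  rewrite vf_der_bracket //; last exact: smooth_vf_der.
  congr (_ - _); rewrite -vf_der_sub; try by do !apply: smooth_vf_der.
  apply: (congr1 (fun f' => vf_der W f' p)); apply/funext => q.
  exact: vf_der_bracket.
transitivity (vf_der (lie_bracket (lie_bracket X Y) Z) f p +
  vf_der (lie_bracket (lie_bracket Y Z) X) f p +
  vf_der (lie_bracket (lie_bracket Z X) Y) f p).
  by rewrite -!vf_der_addl.
have G (a b c a' b' c' : R) :
    a - b - (c - a') + (b' - a' - (a - c')) + (c - c' - (b' - b)) = 0 by ring.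
have E1 := E _ _ _ sX sY sZ; have E2 := E _ _ _ sY sZ sX.
have E3 := E _ _ _ sZ sX sY.
exact: (etrans (congr2 +%R (congr2 +%R E1 E2) E3) (G _ _ _ _ _ _)).
Qed.

End Bracket.

Arguments smooth_brackets {R d} M.

Section ExteriorDerivative.
Context {R : realType} {d : nat} {M : manifold R d}.
Implicit Types (p : M) (X Y Z : vfield M) (eta : form1 M).

Lemma lie_bracketC X Y p : lie_bracket X Y p = - lie_bracket Y X p.
Proof. by rewrite /lie_bracket opprB. Qed.

Lemma ext_dC eta X Y p : ext_d eta X Y p = - ext_d eta Y X p.
Proof.
rewrite /ext_d /app1 lie_bracketC mulNmx mxE.
set a := vf_der X _ _; set b := vf_der Y _ _; set c := (_ *m _) 0 0.
by ring.
Qed.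

(** The identity d (d eta) = 0. Second derivatives combine into commutators
    of derivations, and the terms eta ([[X, Y], Z]) cancel by the Jacobi
    identity. *)
Lemma ext_d_closed eta X Y Z p : smooth_brackets M -> smooth_form1 eta ->
  smooth_vf X -> smooth_vf Y -> smooth_vf Z ->
  vf_der X (ext_d eta Y Z) p - ext_d eta (lie_bracket X Y) Z p
  + (vf_der Y (ext_d eta Z X) p - ext_d eta (lie_bracket Y Z) X p)
  + (vf_der Z (ext_d eta X Y) p - ext_d eta (lie_bracket Z X) Y p) = 0.
Proof.
move=> sB se sX sY sZ.
have se1 V : smooth_vf V -> smooth_fun (app1 eta V) by exact: smooth_app1.
have E U V W : smooth_vf U -> smooth_vf V -> smooth_vf W ->
    vf_der U (ext_d eta V W) p - ext_d eta (lie_bracket U V) W p = 2^-1 *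
    (vf_der V (vf_der U (app1 eta W)) p - vf_der U (vf_der W (app1 eta V)) p
     - vf_der U (app1 eta (lie_bracket V W)) p
     + vf_der W (app1 eta (lie_bracket U V)) p
     + app1 eta (lie_bracket (lie_bracket U V) W) p).
  move=> sU sV sW.
  have s1 : smooth_fun (vf_der V (app1 eta W)) by apply: smooth_vf_der => //; exact: se1.
  have s2 : smooth_fun (vf_der W (app1 eta V)) by apply: smooth_vf_der => //; exact: se1.
  have s3 : smooth_fun (app1 eta (lie_bracket V W)) by apply: se1; exact: sB.
  have s12 := smooth_fun_sub s1 s2; have s123 := smooth_fun_sub s12 s3.
  have D1 := vf_der_scale U (2^-1) p s123.
  have D2 := vf_der_sub U p s12 s3; have D3 := vf_der_sub U p s1 s2.
  have D4 := vf_der_bracket p sU sV (se1 _ sW).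
  have G (D a b c d1 d2 B e f u x y : R) : D = 2^-1 * x -> x = y - c -> y = a - b ->
      B = a - d2 -> e = 2^-1 * (B - f - u) ->
      D - e = 2^-1 * (d2 - b - c + f + u).
    by move=> -> -> -> -> ->; ring.
  exact: (G _ _ _ _ 0 _ _ _ _ _ _ _ D1 D2 D3 D4 erefl).
have G (a b c x y z u v w k : R) : u + v + w = 0 ->
    k * (a - b - x + z + u) + k * (c - a - y + x + v) + k * (b - c - z + y + w) = 0.
  move=> E0; transitivity (k * (u + v + w)); first by ring.
  by rewrite E0 mulr0.
have E1 := E _ _ _ sX sY sZ; have E2 := E _ _ _ sY sZ sX.
have E3 := E _ _ _ sZ sX sY.
apply: (etrans (congr2 +%R (congr2 +%R E1 E2) E3)); apply: G.
have L (u v w : 'rV[R]_d) : u + v + w = 0 ->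
    (u *m eta p) 0 0 + (v *m eta p) 0 0 + (w *m eta p) 0 0 = 0.
  move=> uvw; transitivity (((u + v + w) *m eta p) 0 0); last by rewrite uvw mul0mx mxE.
  by rewrite !mulmxDl [in RHS]mxE; congr (_ + _); rewrite [in RHS]mxE.
exact: (L _ _ _ (jacobi_identity p sB sX sY sZ)).
Qed.

End ExteriorDerivative.

(** * Algebra of the paracontact metric structure *)

(** Only the formal rules of the tensor calculus are used here, so vector fields
    are functions from a set T of points to a module E, [sm] and [smf] select
    the smooth fields and functions, and [der X f] is the derivative of f along
    X. The 1-form eta is g(., xi), and nabla_X Y - nabla_Y X is the bracket. *)

Section ParacontactAlgebra.
Context {R : realFieldType} {T : Type} {E : lmodType R}.
Variables (g : T -> E -> E -> R) (phi : T -> E -> E) (xi : T -> E).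
Variables (sm : (T -> E) -> Prop) (smf : (T -> R) -> Prop).
Variables (der : (T -> E) -> (T -> R) -> T -> R).
Variables (nabla : (T -> E) -> (T -> E) -> T -> E) (h : (T -> E) -> T -> E).
Variables (kappa mu : R).
Implicit Types (X Y Z : T -> E) (f : T -> R) (q : T).

Definition pairing X Y : T -> R := fun q => g q (X q) (Y q).
Local Notation ip := pairing.
Definition tensor_apply X : T -> E := fun q => phi q (X q).
Local Notation P := tensor_apply.
Definition fscale f X : T -> E := fun q => f q *: X q.

Hypothesis gDl : forall q u v w, g q (u + v) w = g q u w + g q v w.
Hypothesis gZl : forall q a u w, g q (a *: u) w = a * g q u w.
Hypothesis gC : forall q u v, g q u v = g q v u.
Hypothesis phiD : forall q u v, phi q (u + v) = phi q u + phi q v.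
Hypothesis phiZ : forall q a u, phi q (a *: u) = a *: phi q u.
Hypothesis phi_phi : forall q u, phi q (phi q u) = u - g q u (xi q) *: xi q.
Hypothesis phi_xi : forall q, phi q (xi q) = 0.
Hypothesis phi_skew : forall q u v, g q (phi q u) v = - g q u (phi q v).
Hypothesis g_xi : forall q, g q (xi q) (xi q) = 1.
Hypothesis smD : forall X Y, sm X -> sm Y -> sm (X + Y).
Hypothesis sm_fscale : forall f X, smf f -> sm X -> sm (fscale f X).
Hypothesis smP : forall X, sm X -> sm (P X).
Hypothesis sm_nabla : forall X Y, sm X -> sm Y -> sm (nabla X Y).
Hypothesis sm_xi : sm xi.
Hypothesis smf_cst : forall c : R, smf (fun=> c).
Hypothesis smf_ip : forall X Y, sm X -> sm Y -> smf (ip X Y).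
Hypothesis der_cst : forall X c q, der X (fun=> c) q = 0.
Hypothesis der_opp : forall X f q, smf f -> der X (fun q => - f q) q = - der X f q.
Hypothesis nabla_linear : forall f X X' Y, smf f -> sm X -> sm X' -> sm Y ->
  nabla (fun q => f q *: X q + X' q) Y = fun q => f q *: nabla X Y q + nabla X' Y q.
Hypothesis nablaDr : forall X Y Y', sm X -> sm Y -> sm Y' ->
  nabla X (Y + Y') = nabla X Y + nabla X Y'.
Hypothesis nabla_leibniz : forall f X Y, smf f -> sm X -> sm Y ->
  nabla X (fscale f Y) = fun q => der X f q *: Y q + f q *: nabla X Y q.
Hypothesis nabla_metric : forall X Y Z q, sm X -> sm Y -> sm Z ->
  der X (ip Y Z) q = ip (nabla X Y) Z q + ip Y (nabla X Z) q.
Hypothesis contact : forall X Y q, sm X -> sm Y ->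
  der X (ip Y xi) q - der Y (ip X xi) q - ip (nabla X Y - nabla Y X) xi q
  = 2 * ip X (P Y) q.
Hypothesis closed_form : forall X Y Z q, sm X -> sm Y -> sm Z ->
  der X (ip Y (P Z)) q - ip (nabla X Y - nabla Y X) (P Z) q
  + (der Y (ip Z (P X)) q - ip (nabla Y Z - nabla Z Y) (P X) q)
  + (der Z (ip X (P Y)) q - ip (nabla Z X - nabla X Z) (P Y) q) = 0.
Hypothesis nondegenerate : forall X, (forall Z q, sm Z -> ip X Z q = 0) -> X = 0.
Hypothesis h_lie : forall Y, sm Y ->
  2 *: h Y = nabla xi (P Y) - nabla (P Y) xi - P (nabla xi Y - nabla Y xi).
Hypothesis curvature_xi : forall X Y, sm X -> sm Y ->
  nabla X (nabla Y xi) - nabla Y (nabla X xi) - nabla (nabla X Y - nabla Y X) xi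
  = kappa *: (fscale (ip Y xi) X - fscale (ip X xi) Y)
    + mu *: (fscale (ip Y xi) (h X) - fscale (ip X xi) (h Y)).

Lemma smZ a X : sm X -> sm (a *: X).
Proof. by move=> sX; exact: (sm_fscale (smf_cst a) sX). Qed.
Lemma smN X : sm X -> sm (- X).
Proof. by move=> sX; rewrite -scaleN1r; exact: smZ. Qed.
Lemma sm0 : sm 0.
Proof. by rewrite -(scale0r xi); exact: smZ. Qed.

(** The g-symmetric part of nabla xi, by [nabla_xi_skew]. It is locked to keep
    the additivity rules from splitting it. *)
Definition shape X : T -> E := locked (nabla X xi + P X).
Local Notation S := shape.

Lemma shapeE X : S X = nabla X xi + P X.
Proof. by rewrite /shape -lock. Qed.

Lemma sm_shape X : sm X -> sm (S X).
Proof.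
by move=> sX; rewrite shapeE; apply: smD; [exact: sm_nabla|exact: smP].
Qed.

Ltac smooth :=
  repeat first [assumption | exact sm_xi | exact sm0 | exact (smf_cst _)
    | apply smf_ip | apply smN | apply smZ | apply sm_shape | apply smD
    | apply sm_fscale | apply smP | apply sm_nabla].
#[local] Hint Extern 0 (sm _) => solve [smooth] : core.
#[local] Hint Extern 0 (smf _) => solve [smooth] : core.

Lemma ipC X Y q : ip X Y q = ip Y X q. Proof. exact: gC. Qed.
Lemma ipDl X Y Z q : ip (X + Y) Z q = ip X Z q + ip Y Z q. Proof. exact: gDl. Qed.
Lemma ipZl a X Z q : ip (a *: X) Z q = a * ip X Z q. Proof. exact: gZl. Qed.
Lemma ipNl X Z q : ip (- X) Z q = - ip X Z q.
Proof. by rewrite -scaleN1r ipZl mulN1r. Qed.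
Lemma ipDr X Y Z q : ip X (Y + Z) q = ip X Y q + ip X Z q.
Proof. by rewrite ipC ipDl !(ipC _ X). Qed.
Lemma ipZr a X Z q : ip X (a *: Z) q = a * ip X Z q.
Proof. by rewrite ipC ipZl ipC. Qed.
Lemma ipNr X Z q : ip X (- Z) q = - ip X Z q.
Proof. by rewrite ipC ipNl ipC. Qed.
Lemma ip0l Z q : ip 0 Z q = 0.
Proof. by rewrite -[0 in LHS](scale0r (0 : T -> E)) ipZl mul0r. Qed.
Let ipE := (ipDl, ipDr, ipNl, ipNr, ipZl, ipZr).

Lemma PD X Y : P (X + Y) = P X + P Y.
Proof. by apply/funext => q; exact: phiD. Qed.
Lemma PZ a X : P (a *: X) = a *: P X.
Proof. by apply/funext => q; exact: phiZ. Qed.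
Lemma PN X : P (- X) = - P X.
Proof. by rewrite -scaleN1r PZ scaleN1r. Qed.
Lemma P0 : P 0 = 0.
Proof. by rewrite -[0 in LHS](scale0r (0 : T -> E)) PZ scale0r. Qed.
Lemma PP X : P (P X) = X - fscale (ip X xi) xi.
Proof. by apply/funext => q; exact: phi_phi. Qed.
Lemma Pxi : P xi = 0.
Proof. by apply/funext => q; exact: phi_xi. Qed.
Lemma ipP X Y q : ip (P X) Y q = - ip X (P Y) q.
Proof. exact: phi_skew. Qed.
Lemma ipPxi X q : ip (P X) xi q = 0.
Proof. by rewrite ipP Pxi ipC ip0l oppr0. Qed.

Lemma nablaDl X Y Z : sm X -> sm Y -> sm Z ->
  nabla (X + Y) Z = nabla X Z + nabla Y Z.
Proof.
move=> sX sY sZ; have := nabla_linear (smf_cst 1) sX sY sZ.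
have -> : (fun q => 1 *: X q + Y q) = X + Y by apply/funext => q; rewrite scale1r.
by move=> ->; apply/funext => q; rewrite scale1r.
Qed.
Lemma nabla0l Z : sm Z -> nabla 0 Z = 0.
Proof.
move=> sZ; have D := nablaDl sm0 sm0 sZ; rewrite addr0 in D.
by apply: (@addrI _ (nabla 0 Z)); rewrite -D addr0.
Qed.
Lemma nablaNl X Z : sm X -> sm Z -> nabla (- X) Z = - nabla X Z.
Proof.
move=> sX sZ; apply/eqP; rewrite -addr_eq0 addrC -nablaDl ?subrr ?nabla0l //; exact: smN.
Qed.
Lemma nabla_fscalel f X Z : smf f -> sm X -> sm Z ->
  nabla (fscale f X) Z = fscale f (nabla X Z).
Proof.
move=> sf sX sZ; have := nabla_linear sf sX sm0 sZ; rewrite nabla0l //.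
have -> : (fun q => f q *: X q + 0) = fscale f X by apply/funext => q; rewrite addr0.
by move=> ->; apply/funext => q; rewrite addr0.
Qed.
Lemma nablaZr a X Z : sm X -> sm Z -> nabla X (a *: Z) = a *: nabla X Z.
Proof.
move=> sX sZ; rewrite [LHS](nabla_leibniz (smf_cst a) sX sZ).
by apply/funext => q; rewrite der_cst scale0r add0r.
Qed.
Lemma nablaNr X Z : sm X -> sm Z -> nabla X (- Z) = - nabla X Z.
Proof. by move=> sX sZ; rewrite -scaleN1r nablaZr // scaleN1r. Qed.
Lemma nabla0r X : sm X -> nabla X 0 = 0.
Proof. by move=> sX; rewrite -{1}(scale0r xi) nablaZr // scale0r. Qed.

Lemma nabla_xi_xi X q : sm X -> ip (nabla X xi) xi q = 0.
Proof.
move=> sX; have := nabla_metric q sX sm_xi sm_xi.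
have -> : ip xi xi = fun=> 1 by apply/funext => t; exact: g_xi.
by rewrite der_cst (ipC xi); lra.
Qed.

(** The skew part of nabla xi is d eta, because eta is g(., xi) and nabla is
    metric and torsion-free. *)
Lemma nabla_xi_skew X Y q : sm X -> sm Y ->
  ip (nabla X xi) Y q - ip (nabla Y xi) X q = 2 * ip X (P Y) q.
Proof.
move=> sX sY; rewrite -contact // !nabla_metric // !ipE.
by rewrite (ipC Y) (ipC X (nabla Y xi)); ring.
Qed.

Lemma nabla_xi_geodesic : nabla xi xi = 0.
Proof.
apply: nondegenerate => Z q sZ; have := nabla_xi_skew q sm_xi sZ.
by rewrite nabla_xi_xi // ipC -[ip xi _ q]opprK -ipP Pxi ip0l (ipC Z); lra.
Qed.

Lemma nabla_xiE X : nabla X xi = S X - P X.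
Proof. by rewrite shapeE addrK. Qed.

Lemma shapeD X Y : sm X -> sm Y -> S (X + Y) = S X + S Y.
Proof. by move=> sX sY; rewrite !shapeE nablaDl // PD addrACA. Qed.

Lemma shapeN X : sm X -> S (- X) = - S X.
Proof. by move=> sX; rewrite !shapeE nablaNl // PN opprD. Qed.

Lemma shapeC X Y q : sm X -> sm Y -> ip (S X) Y q = ip X (S Y) q.
Proof.
move=> sX sY; have := nabla_xi_skew q sX sY.
by rewrite !shapeE !ipE ipP (ipC X (nabla Y xi)); lra.
Qed.

Lemma shape_xi : S xi = 0.
Proof. by rewrite !shapeE nabla_xi_geodesic Pxi addr0. Qed.

Lemma ip_shape_xi X q : sm X -> ip (S X) xi q = 0.
Proof. by move=> sX; rewrite shapeC // shape_xi ipC ip0l. Qed.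

Lemma shape_fscale_xi f : smf f -> S (fscale f xi) = 0.
Proof.
move=> sf; rewrite !shapeE nabla_fscalel // nabla_xi_geodesic.
by apply/funext => q; rewrite /fscale /P fctE scaler0 phiZ phi_xi scaler0 addr0.
Qed.

Lemma shape_PP X : sm X -> S (P (P X)) = S X.
Proof.
by move=> sX; rewrite PP shapeD ?shapeN ?shape_fscale_xi ?oppr0 ?addr0 //; auto.
Qed.

Lemma PP_shape X : sm X -> P (P (S X)) = S X.
Proof.
move=> sX; rewrite PP; apply/funext => q.
by rewrite !fctE /fscale ip_shape_xi // scale0r subr0.
Qed.

(** This is (nabla_X phi) Y. *)
Definition dphi X Y : T -> E := nabla X (P Y) - P (nabla X Y).

Lemma dphi_skew X Y Z q : sm X -> sm Y -> sm Z ->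
  ip (dphi X Y) Z q = - ip (dphi X Z) Y q.
Proof.
move=> sX sY sZ; have := nabla_metric q sX (smP sY) sZ.
have -> : ip (P Y) Z = fun t => - ip Y (P Z) t by apply/funext => t; exact: ipP.
rewrite der_opp ?nabla_metric //.
have e1 := ipC Y (nabla X (P Z)) q; have e2 := ipC (P (nabla X Z)) Y q.
have e3 := ipP Y (nabla X Z) q; have e4 := ipP (nabla X Y) Z q.
by rewrite /dphi !ipE; lra.
Qed.

(** Closedness of the 2-form g(., phi .) = d eta, expressed by a torsion-free
    connection. *)
Lemma dphi_cyclic X Y Z q : sm X -> sm Y -> sm Z ->
  ip (dphi X Y) Z q + ip (dphi Y Z) X q + ip (dphi Z X) Y q = 0.
Proof.
move=> sX sY sZ; rewrite (dphi_skew q sX sY sZ) (dphi_skew q sY sZ sX).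
rewrite (dphi_skew q sZ sX sY).
have := closed_form q sX sY sZ.
rewrite !nabla_metric //.
rewrite /dphi !ipE !ipP.
rewrite (ipC Y (nabla X (P Z))) (ipC Z (nabla Y (P X))) (ipC X (nabla Z (P Y))).
by lra.
Qed.

(** This is nabla_xi phi. *)
Let C Y := dphi xi Y.
Let W Y := P (S Y) + S (P Y).

(** The cyclic identity with xi as one argument: the two other terms involve
    only phi nabla xi, as phi xi = 0. *)
Lemma dphi_xi_shape Y : sm Y -> C Y = - W Y.
Proof.
move=> sY; apply/eqP; rewrite -addr_eq0; apply/eqP.
apply: nondegenerate => Z q sZ.
have := dphi_cyclic q sm_xi sY sZ.
rewrite (dphi_skew q sY sZ sm_xi) -/(C Y) /W /dphi Pxi !nabla0r // !nabla_xiE.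
rewrite !sub0r !PD !PN !ipE.
have e1 := ipP (S Z) Y q; have e2 := shapeC q sZ (smP sY).
have e3 := ipC Z (S (P Y)) q.
have e4 := ipP (P Z) Y q; have e5 := ipC (P Z) (P Y) q; have e6 := ipP (P Y) Z q.
by lra.
Qed.

(** The derivative along xi of phi^2 = id - eta (x) xi vanishes, since xi is
    parallel along itself. *)
Lemma dphi_xi_anticommute Y : sm Y -> C (P Y) + P (C Y) = 0.
Proof.
move=> sY; rewrite /C /dphi !PD !PN addrA subrK.
rewrite !PP nablaDr // nablaNr // nabla_leibniz //.
apply/funext => q; rewrite !fctE /fscale nabla_metric // nabla_xi_geodesic.
by rewrite (ipC Y) ip0l addr0 scaler0 addr0 subrr.
Qed.

Lemma anticommutator_commute Y : sm Y -> W (P Y) = P (W Y).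
Proof. by move=> sY; rewrite /W shape_PP // PD PP_shape // addrC. Qed.

(** phi is injective on the kernel of eta. *)
Lemma eq0_of_P X : (forall q, ip X xi q = 0) -> P X = 0 -> X = 0.
Proof.
move=> X0 PX; have := PP X; rewrite PX P0 => /eqP.
have -> : fscale (ip X xi) xi = 0 by apply/funext => q; rewrite /fscale X0 scale0r.
by rewrite subr0 eq_sym => /eqP.
Qed.

(** nabla_xi phi anticommutes with phi, while its opposite W commutes with
    phi; hence phi (nabla_xi phi) = 0, and the values are horizontal. *)
Lemma dphi_xi0 Y : sm Y -> C Y = 0.
Proof.
move=> sY; apply: eq0_of_P => [q|].
  by rewrite dphi_xi_shape // !ipE ipPxi ip_shape_xi //; lra.
have := dphi_xi_anticommute sY.
rewrite dphi_xi_shape // anticommutator_commute // -PN -dphi_xi_shape //.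
by rewrite -mulr2n -scaler_nat => /eqP; rewrite scaler_eq0 pnatr_eq0 => /eqP.
Qed.

Lemma shapeP Y : sm Y -> S (P Y) = - P (S Y).
Proof.
move=> sY; apply/eqP; rewrite -addr_eq0 addrC -/(W Y) -oppr_eq0.
by rewrite -dphi_xi_shape // dphi_xi0.
Qed.

Lemma nabla_xi_P Y : sm Y -> nabla xi (P Y) = P (nabla xi Y).
Proof. by move=> sY; apply/eqP; rewrite -subr_eq0 -[_ - _]/(C Y) dphi_xi0. Qed.

Lemma eq_by_pairing X Y : (forall Z q, sm Z -> ip X Z q = ip Y Z q) -> X = Y.
Proof.
move=> XY; apply/eqP; rewrite -subr_eq0; apply/eqP; apply: nondegenerate => Z q sZ.
by rewrite !ipE XY // subrr.
Qed.

(** As nabla_xi phi = 0, the Lie derivative of phi along xi is the commutator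
    of phi with nabla xi = S - phi, which is 2 phi S because S and phi
    anticommute. *)
Lemma h_shape Y : sm Y -> h Y = P (S Y).
Proof.
move=> sY; apply: eq_by_pairing => Z q sZ.
have := congr1 (fun X => ip X Z q) (h_lie sY).
by rewrite nabla_xi_P // !nabla_xiE shapeP // !(PD, PN) !ipE; lra.
Qed.

(** The Riccati equation, from the curvature R(Y, xi) xi. *)
Lemma nabla_xi_shape Y : sm Y -> nabla xi (S Y) - S (nabla xi Y)
  = - S (S Y) - (1 + kappa) *: P (P Y) - mu *: P (S Y).
Proof.
move=> sY; apply: eq_by_pairing => Z q sZ.
have := congr1 (fun X => ip X Z q) (curvature_xi sY sm_xi).
have fs1 X : fscale (ip xi xi) X = X.
  by apply/funext => t; rewrite /fscale {1}/ip g_xi scale1r.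
rewrite !fs1 !h_shape // shape_xi P0.
have -> : fscale (ip Y xi) 0 = 0 by apply/funext => t; exact: scaler0.
rewrite -PP nabla_xi_geodesic nabla0r // !nabla_xiE nablaDr // nablaNr //.
rewrite nabla_xi_P // !(shapeD, shapeN) // shapeP // !(PD, PN) !ipE ip0l.
by lra.
Qed.

(** In the Riccati equation nabla_xi S and mu phi S anticommute with phi,
    whereas S^2 + (1 + kappa) phi^2 commutes with it. Comparing the equation at
    phi Y with phi applied to the equation at Y leaves only the latter. *)
Lemma shape_shape Y : sm Y -> S (S Y) = (- 1 - kappa) *: P (P Y).
Proof.
move=> sY; apply/eqP; rewrite -subr_eq0; apply/eqP; apply: eq0_of_P => [q|].
  by rewrite !ipE ip_shape_xi // ipPxi; lra.
apply: eq_by_pairing => Z q sZ; rewrite ip0l.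
have := congr1 (fun X => ip X Z q) (nabla_xi_shape (smP sY)).
have := congr1 (fun X => ip (P X) Z q) (nabla_xi_shape sY).
rewrite !(PD, PN, PZ) nabla_xi_P // -(nabla_xi_P (sm_shape sY)).
rewrite shapeP // nablaNr // (shapeP (sm_nabla sm_xi sY)).
rewrite !(shapeN, shapeP, PN) // !ipE.
by lra.
Qed.

(** This is (nabla_X S) Y. *)
Definition dshape X Y : T -> E := nabla X (S Y) - S (nabla X Y).

Lemma dshape_sym X Y Z q : sm X -> sm Y -> sm Z ->
  ip (dshape X Y) Z q = ip (dshape X Z) Y q.
Proof.
move=> sX sY sZ; have := nabla_metric q sX (sm_shape sY) sZ.
have -> : ip (S Y) Z = ip Y (S Z) by apply/funext => t; exact: shapeC.
rewrite nabla_metric //.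
have e1 := ipC Y (nabla X (S Z)) q; have e2 := ipC (S (nabla X Z)) Y q.
have e3 := shapeC q sY (sm_nabla sX sZ).
have e4 := shapeC q (sm_nabla sX sY) sZ.
by rewrite /dshape !ipE; lra.
Qed.

Definition horizontal X := forall q, ip X xi q = 0.

(** Here R(X, Y) xi = 0, and nabla xi = S - phi, so nabla S and nabla phi have
    the same skew-symmetrization; that of nabla phi is one term by the cyclic
    identity. *)
Lemma codazzi X Y Z q : sm X -> sm Y -> sm Z -> horizontal X -> horizontal Y ->
  ip (dshape X Y) Z q - ip (dshape Y X) Z q = - ip (dphi Z X) Y q.
Proof.
move=> sX sY sZ hX hY.
have := congr1 (fun V => ip V Z q) (curvature_xi sX sY).
have fs0 V W' : horizontal V -> fscale (ip V xi) W' = 0.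
  by move=> hV; apply/funext => t; rewrite /fscale hV scale0r.
rewrite !fs0 // subrr !scaler0 addr0 ip0l !nabla_xiE !(nablaDr, nablaNr) //.
rewrite !(shapeD, shapeN, PD, PN) // !ipE.
have := dphi_cyclic q sX sY sZ; rewrite (dphi_skew q sY sZ sX).
by rewrite /dphi /dshape !ipE; lra.
Qed.

Lemma PP_horizontal X : horizontal X -> P (P X) = X.
Proof.
move=> hX; rewrite PP; apply/funext => q.
by rewrite !fctE /fscale hX scale0r subr0.
Qed.

Lemma horizontalP X : horizontal (P X).
Proof. by move=> q; exact: ipPxi. Qed.

(** The derivative of phi^2, which is the identity on the kernel of eta. *)
Lemma dphi_P X Y Z q : sm X -> sm Y -> sm Z -> horizontal Y -> horizontal Z ->
  ip (dphi X (P Y)) Z q = ip (dphi X Y) (P Z) q.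
Proof.
move=> sX sY sZ hY hZ; rewrite /dphi PP_horizontal // !ipE.
have e1 := ipP (nabla X (P Y)) Z q.
have e2 := ipP (nabla X Y) (P Z) q; rewrite PP_horizontal // in e2.
by lra.
Qed.

Section Eigenfields.
Variable s : R.
Hypothesis s0 : s != 0.

Definition eigenfield r X := sm X /\ S X = r *: X.

Lemma eigenfield_horizontal r X : r != 0 -> eigenfield r X -> horizontal X.
Proof.
move=> r0 [sX SX] q; apply: (mulfI r0).
by rewrite mulr0 -ipZl -SX ip_shape_xi.
Qed.

Lemma eigenfieldP r X : eigenfield r X -> eigenfield (- r) (P X).
Proof. by move=> [sX SX]; split=> //; rewrite shapeP // SX PZ scaleNr. Qed.

(** The form vanishes for equal eigenvalues; for opposite ones it is the
    component of nabla_X Y along the other eigendistribution. *)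
Lemma dshape_eigen r t X Y Z q : sm X -> eigenfield r Y -> eigenfield t Z ->
  ip (dshape X Y) Z q = (r - t) * ip (nabla X Y) Z q.
Proof.
move=> sX [sY SY] [sZ SZ]; rewrite /dshape SY nablaZr // !ipE.
by rewrite shapeC // SZ !ipE; ring.
Qed.

Lemma dphi_eigen r X Y Z q : r != 0 ->
  eigenfield r X -> eigenfield r Y -> eigenfield r Z -> ip (dphi Z X) Y q = 0.
Proof.
move=> r0 eX eY eZ; have [sX _] := eX; have [sY _] := eY; have [sZ _] := eZ.
have := codazzi q sX sY sZ (eigenfield_horizontal r0 eX) (eigenfield_horizontal r0 eY).
by rewrite !(dshape_eigen (r := r) (t := r)) //; lra.
Qed.

(** The form F a b c = g ((nabla_a phi) b, phi c) on eigenfields of s is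
    symmetric in a, b and skew in b, c, hence zero; by [codazzi] the component
    in question is a multiple of F Y X (phi Z). *)
Lemma nabla_eigenfield X Y Z q :
  eigenfield s X -> eigenfield s Y -> eigenfield (- s) Z -> ip (nabla X Y) Z q = 0.
Proof.
have Ns0 : - s != 0 by rewrite oppr_eq0.
move=> eX eY eZ.
have hor V : eigenfield s V -> horizontal V by exact: eigenfield_horizontal.
have horN V : eigenfield (- s) V -> horizontal V by exact: eigenfield_horizontal.
have smE r V : eigenfield r V -> sm V by case.
have eP V : eigenfield s V -> eigenfield (- s) (P V) by exact: eigenfieldP.
pose F a b c := ip (dphi a b) (P c) q.
have QF a b c : eigenfield s a -> eigenfield s b -> eigenfield s c ->
    ip (dshape a b) (P c) q = - F b a c.
  move=> ea eb ec; have [sa _] := ea; have [sb _] := eb; have [sc _] := ec.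
  have := codazzi q sa (smP sc) sb (hor _ ea) (@horizontalP c).
  rewrite (dshape_eigen q (smP sc) ea eb) subrr mul0r subr0 => <-.
  exact: dshape_sym.
have Fsym a b c : eigenfield s a -> eigenfield s b -> eigenfield s c ->
    F a b c = F b a c.
  move=> ea eb ec; have [sa _] := ea; have [sb _] := eb; have [sc _] := ec.
  (* a = phi (phi a), and the eigenfields P a, P b, P c share an eigenvalue. *)
  have T0 : ip (dphi (P c) a) b q = 0.
    rewrite -(PP_horizontal (hor _ ea)) (dphi_P q _ _ sb (@horizontalP a) (hor _ eb)) //.
    exact: dphi_eigen Ns0 (eP _ ea) (eP _ eb) (eP _ ec).
  have := codazzi q sa sb (smP sc) (hor _ ea) (hor _ eb).
  by rewrite T0 !QF //; lra.
have Fskew a b c : eigenfield s a -> eigenfield s b -> eigenfield s c ->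
    F a b c = - F a c b.
  move=> ea eb ec; have [sa _] := ea; have [sb _] := eb; have [sc _] := ec.
  rewrite /F -dphi_P //; try exact: hor.
  exact: dphi_skew.
(* Alternating the two symmetries six times changes the sign of F. *)
have F0 a b c : eigenfield s a -> eigenfield s b -> eigenfield s c -> F a b c = 0.
  move=> ea eb ec; suff : F a b c = - F a b c by lra.
  by rewrite {1}Fsym // Fskew // Fsym // Fskew // opprK Fsym // Fskew.
have ePZ : eigenfield s (P Z) by rewrite -[s]opprK; exact: eigenfieldP.
have [sX _] := eX.
have := QF _ _ _ eX eY ePZ; rewrite F0 // oppr0 (PP_horizontal (horN _ eZ)).
rewrite (dshape_eigen q sX eY eZ) opprK => /eqP.
by rewrite mulf_eq0 -mulr2n mulrn_eq0 (negPf s0) => /eqP.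
Qed.

End Eigenfields.

(** The results in terms of h alone, ready to be read pointwise. *)
Theorem kappa_mu_structure :
  [/\ forall Y, sm Y -> nabla Y xi = P (h Y) - P Y,
      forall Y, sm Y -> P (h (P (h Y))) = (- 1 - kappa) *: P (P Y),
      forall X Y q, sm X -> sm Y -> ip (P (h X)) Y q = ip X (P (h Y)) q,
      forall Y, sm Y -> P (h (P Y)) = - P (P (h Y)) &
      forall s X Y Z q, s != 0 -> sm X -> sm Y -> sm Z ->
        P (h X) = s *: X -> P (h Y) = s *: Y -> P (h Z) = - s *: Z ->
        ip (nabla X Y) Z q = 0].
Proof.
have Ph Y : sm Y -> P (h Y) = S Y by move=> sY; rewrite h_shape // PP_shape.
split=> [Y sY|Y sY|X Y q sX sY|Y sY|s X Y Z q s0 sX sY sZ].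
- by rewrite Ph // nabla_xiE.
- by rewrite !Ph // shape_shape.
- by rewrite !Ph // shapeC.
- by rewrite !Ph // shapeP.
by rewrite !Ph // => SX SY SZ; exact: (nabla_eigenfield s0).
Qed.

End ParacontactAlgebra.

(** * Eigendistributions on a paracontact (kappa, mu)-manifold *)

(** Since x A^2 = 0, the vector x A is killed by A^2 too, so it is a multiple
    c x of x; then x A^2 = c^2 x forces c = 0. *)
Lemma involutive_kernel (R : fieldType) d (A : 'M[R]_d) (e : 'cV[R]_d)
    (x : 'rV[R]_d) (l : R) : l != 0 -> (x *m e) 0 0 = 1 ->
  A *m A = l *: (1%:M - e *m x) -> x *m A = 0.
Proof.
move=> l0 xe1 AA.
have xe : x *m e = 1%:M by apply/matrixP => i j; rewrite !ord1 xe1 mxE.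
have xAA : x *m A *m A = 0.
  by rewrite -mulmxA AA -scalemxAr mulmxBr mulmx1 mulmxA xe mul1mx subrr scaler0.
pose c := (x *m A *m e) 0 0.
have xA : x *m A = c *: x.
  have : x *m A *m A *m A = 0 by rewrite xAA mul0mx.
  rewrite -mulmxA AA -scalemxAr => /eqP; rewrite scaler_eq0 (negPf l0) /=.
  by rewrite mulmxBr mulmx1 subr_eq0 mulmxA [x *m A *m e]mx11_scalar mul_scalar_mx => /eqP.
have c0 : c = 0.
  move: xAA; rewrite xA -scalemxAl xA scalerA => /(congr1 (fun y => (y *m e) 0 0)).
  by rewrite -scalemxAl mxE xe1 mulr1 mul0mx mxE => /eqP; rewrite mulf_eq0 orbb => /eqP.
by rewrite xA c0 scale0r.
Qed.

Lemma row_basis_of_rank (R : fieldType) m d (L : 'M[R]_(m, d)) k :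
  \rank L = k -> exists2 F : 'M[R]_(k, d), (F == L)%MS & row_free F.
Proof.
move=> <-; exists (row_base L); last exact: row_base_free.
by apply/eqmxP; exact: eq_row_base.
Qed.

Section KappaMuManifold.
Context {R : realType} {n : nat} {M : manifold R n.*2.+1}.
Variables (kappa mu : R) (phi : tensor11 M) (xi : vfield M) (eta : form1 M).
Variables (g : tensor02 M) (h : tensor11 M).
Variable nabla : vfield M -> vfield M -> vfield M.
Hypothesis pkm : paracontact_kappa_mu kappa mu phi xi eta g h nabla.
Implicit Types (p : M) (X Y Z : vfield M) (u v w : 'rV[R]_n.*2.+1).

Let pcm := pkm_pcm pkm.
Let apc := pcm_apc pcm.
Let lc := pkm_nabla pkm.
Let ac : affine_connection nabla. Proof. by case: lc. Qed.

Lemma pappDl (G : 'M[R]_n.*2.+1) u v w : papp G (u + v) w = papp G u w + papp G v w.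
Proof. by rewrite /papp !mulmxDl mxE. Qed.
Lemma pappZl (G : 'M[R]_n.*2.+1) a u w : papp G (a *: u) w = a * papp G u w.
Proof. by rewrite /papp -!scalemxAl mxE. Qed.
Lemma papp_sym p u v : papp (g p) u v = papp (g p) v u.
Proof.
have [_ gT _ _] := pcm_metric pcm.
rewrite /papp; transitivity ((v *m (g p)^T *m u^T)^T 0 0).
  by rewrite !trmx_mul !trmxK mulmxA.
by rewrite mxE gT.
Qed.
Lemma pappDr p u v w : papp (g p) u (v + w) = papp (g p) u v + papp (g p) u w.
Proof. by rewrite papp_sym pappDl !(papp_sym p _ u). Qed.
Lemma pappZr p a u w : papp (g p) u (a *: w) = a * papp (g p) u w.
Proof. by rewrite papp_sym pappZl papp_sym. Qed.

Lemma papp_eq0 p u : (forall v, papp (g p) u v = 0) -> u = 0.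
Proof.
have [_ _ gU _] := pcm_metric pcm.
move=> u0; have : u *m g p = 0.
  apply/rowP => j; have := u0 (delta_mx 0 j).
  by rewrite /papp trmx_delta -colE !mxE.
by move=> /(congr1 (mulmx^~ (invmx (g p)))); rewrite mulmxK ?gU // mul0mx.
Qed.

Lemma bracket_nabla X Y : smooth_vf X -> smooth_vf Y ->
  lie_bracket X Y = nabla X Y - nabla Y X.
Proof. by move=> sX sY; apply/funext => p; have [_ tf _] := lc; rewrite -tf. Qed.

Lemma smooth_vf_nabla X Y : smooth_vf X -> smooth_vf Y -> smooth_vf (nabla X Y).
Proof. by case: ac => sn _ _ _; exact: sn. Qed.

Lemma smooth_bracketsP : smooth_brackets M.
Proof.
move=> X Y sX sY; rewrite bracket_nabla //.
apply: smooth_vf_add; first exact: smooth_vf_nabla.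
rewrite (_ : - _ = (fun p => -1 *: nabla Y X p)); last first.
  by apply/funext => p; rewrite scaleN1r.
by apply: smooth_vf_scale; [exact: smooth_fun_cst|exact: smooth_vf_nabla].
Qed.

Lemma ext_d_phi X Y : smooth_vf X -> smooth_vf Y ->
  ext_d eta X Y = app2 g X (app11 phi Y).
Proof. by move=> sX sY; apply/funext => p; exact: (pcm_contact pcm). Qed.

Lemma phi_skew p u v : papp (g p) (u *m phi p) v = - papp (g p) u (v *m phi p).
Proof.
have [X sX <-] := vf_through p u; have [Y sY <-] := vf_through p v.
have E1 := pcm_contact pcm sX sY p; have E2 := pcm_contact pcm sY sX p.
rewrite papp_sym; apply: etrans (esym E2) _.
by rewrite ext_dC E1.
Qed.

Lemma phi_phi p : phi p *m phi p = 1%:M - eta p *m xi p.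
Proof. exact: (apc_phi2 apc). Qed.

Lemma xi_phi p : xi p *m phi p = 0.
Proof.
apply: (@involutive_kernel _ _ _ (eta p) _ 1); rewrite ?oner_eq0 //.
- exact: (apc_eta_xi apc).
- by rewrite scale1r phi_phi.
Qed.

(** Compatibility of g and phi at the pair (u, xi), with phi xi = 0. *)
Lemma papp_xi p u : papp (g p) u (xi p) = (u *m eta p) 0 0.
Proof.
have [X sX <-] := vf_through p u.
have := pcm_compat pcm sX (apc_xi apc) p.
rewrite (apc_eta_xi apc) mulr1 /app2 /app11 xi_phi.
have -> : papp (g p) (X p *m phi p) 0 = 0 by rewrite /papp trmx0 mulmx0 mxE.
by move=> /esym/eqP; rewrite addrC subr_eq0 => /eqP <-.
Qed.

Lemma eta_field X : app2 g X xi = app1 eta X.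
Proof. by apply/funext => p; exact: papp_xi. Qed.

Lemma smooth_app11_h X : smooth_vf X -> smooth_vf (app11 h X).
Proof.
move=> sX; have [s2h _] := pkm_h pkm.
rewrite (_ : app11 h X = fun p => 2^-1 *: app11 (fun q => 2 *: h q) X p).
  by apply: smooth_vf_scale; [exact: smooth_fun_cst|exact: smooth_app11].
by apply/funext => p; rewrite /app11 -scalemxAr scalerA mulVf ?pnatr_eq0 // scale1r.
Qed.

(* B stands for phi h; a variable keeps its products from being reassociated. *)
Variable B : tensor11 M.
Hypothesis BE : forall p, B p = phi_h phi h p.

Lemma phi_h_structure :
  [/\ forall Y, smooth_vf Y -> nabla Y xi = app11 phi (app11 h Y) - app11 phi Y,
      forall Y, smooth_vf Y -> app11 phi (app11 h (app11 phi (app11 h Y))) =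
        (- 1 - kappa) *: app11 phi (app11 phi Y),
      forall X Y p, smooth_vf X -> smooth_vf Y ->
        app2 g (app11 phi (app11 h X)) Y p = app2 g X (app11 phi (app11 h Y)) p,
      forall Y, smooth_vf Y -> app11 phi (app11 h (app11 phi Y)) =
        - app11 phi (app11 phi (app11 h Y)) &
      forall s X Y Z p, s != 0 -> smooth_vf X -> smooth_vf Y -> smooth_vf Z ->
        app11 phi (app11 h X) = s *: X -> app11 phi (app11 h Y) = s *: Y ->
        app11 phi (app11 h Z) = - s *: Z -> app2 g (nabla X Y) Z p = 0].
Proof.
have [sn nl nr nle] := ac; have [_ tf met] := lc.
apply: (@kappa_mu_structure R M 'rV[R]_(n.*2.+1) (fun p => papp (g p))
  (fun p v => v *m phi p) xi (@smooth_vf R _ M) (@smooth_fun R _ M)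
  (@vf_der R _ M) nabla (app11 h) kappa mu).
- by move=> p u v w; exact: pappDl.
- by move=> p a u w; exact: pappZl.
- by move=> p u v; exact: papp_sym.
- by move=> p u v; exact: mulmxDl.
- by move=> p a u; rewrite -scalemxAl.
- move=> p u; rewrite -mulmxA phi_phi mulmxBr mulmx1 papp_xi mulmxA.
  by rewrite [u *m eta p]mx11_scalar mul_scalar_mx -[in RHS]mx11_scalar.
- exact: xi_phi.
- by move=> p u v; exact: phi_skew.
- by move=> p; rewrite papp_xi; exact: (apc_eta_xi apc).
- by move=> X Y; exact: smooth_vf_add.
- by move=> f X; exact: smooth_vf_scale.
- by move=> X sX; apply: (smooth_app11 _ sX); exact: (apc_phi apc).
- exact: smooth_vf_nabla.
- exact: (apc_xi apc).
- exact: smooth_fun_cst.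
- by move=> X Y sX sY; apply: smooth_app2 => //; case: (pcm_metric pcm).
- by move=> X c p; exact: vf_der_cst.
- move=> X f p sf; apply: etrans (etrans (vf_der_scale X (-1) p sf) (mulN1r _)).
  apply: (congr1 (fun f' => vf_der X f' p)); apply/funext => q.
  by rewrite mulN1r.
- by move=> f X X' Y sf sX sX' sY; apply/funext => p; exact: nl.
- by move=> X Y Y' sX sY sY'; apply/funext => p; exact: nr.
- by move=> f X Y sf sX sY; apply/funext => p; exact: nle.
- by move=> X Y Z p sX sY sZ; exact: met.
- move=> X Y p sX sY; have E := pcm_contact pcm sX sY p.
  transitivity (2 * ext_d eta X Y p); last by rewrite E.
  rewrite /ext_d -!eta_field (bracket_nabla sX sY) mulrA mulfV ?pnatr_eq0 // mul1r.
  by [].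
- move=> X Y Z p sX sY sZ; have sB := smooth_bracketsP.
  have K U V W : smooth_vf U -> smooth_vf V -> smooth_vf W ->
      vf_der U (app2 g V (app11 phi W)) p
      - app2 g (nabla U V - nabla V U) (app11 phi W) p
      = vf_der U (ext_d eta V W) p - ext_d eta (lie_bracket U V) W p.
    move=> sU sV sW; apply: (congr2 (fun a b => a - b)).
      exact: (congr1 (fun f => vf_der U f p) (esym (ext_d_phi sV sW))).
    rewrite -(bracket_nabla sU sV).
    exact: (congr1 (fun f => f p) (esym (ext_d_phi (sB _ _ sU sV) sW))).
  have E := ext_d_closed p sB (apc_eta apc) sX sY sZ.
  apply: etrans E.
  exact: (congr2 +%R (congr2 +%R (K _ _ _ sX sY sZ) (K _ _ _ sY sZ sX))
            (K _ _ _ sZ sX sY)).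
- move=> X X0; apply/funext => p; apply: (@papp_eq0 p) => v.
  by have [Z sZ <-] := vf_through p v; exact: X0.
- move=> Y sY; have [_ lh] := pkm_h pkm; apply/funext => p.
  have sx := apc_xi apc; have sPY := smooth_app11 (apc_phi apc) sY.
  have := lh Y sY p; rewrite !bracket_nabla // /app11 -scalemxAr.
  by [].
- move=> X Y sX sY; have sx := apc_xi apc; apply/funext => p.
  have := pkm_curvature pkm sX sY p; rewrite /curvature bracket_nabla //.
  by rewrite -!eta_field.
Qed.

Lemma app11_phi_h X : app11 phi (app11 h X) = app11 B X.
Proof. by apply/funext => p; rewrite /app11 BE /phi_h mulmxA. Qed.

Lemma smooth_app11_B X : smooth_vf X -> smooth_vf (app11 B X).
Proof.
move=> sX; rewrite -app11_phi_h; apply: smooth_app11; first exact: (apc_phi apc).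
exact: smooth_app11_h.
Qed.

Lemma B_sym p u v : papp (g p) (u *m B p) v = papp (g p) u (v *m B p).
Proof.
have [_ _ sym _ _] := phi_h_structure.
have [X sX <-] := vf_through p u; have [Y sY <-] := vf_through p v.
by have := sym X Y p sX sY; rewrite !app11_phi_h.
Qed.

Lemma B_B p : B p *m B p = (- 1 - kappa) *: (1%:M - eta p *m xi p).
Proof.
have [_ sq _ _ _] := phi_h_structure.
apply/row_matrixP => i; rewrite !rowE; set v := delta_mx _ _.
have [X sX <-] := vf_through p v.
have E := congr1 (fun V => V p) (sq X sX); rewrite !app11_phi_h in E.
transitivity ((- 1 - kappa) *: (X p *m phi p *m phi p)).
  by rewrite mulmxA; exact: E.
by rewrite -mulmxA phi_phi scalemxAr.
Qed.

Lemma phi_B p : phi p *m B p = - (B p *m phi p).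
Proof.
have [_ _ _ anti _] := phi_h_structure.
apply/row_matrixP => i; rewrite !rowE; set v := delta_mx _ _.
have [X sX <-] := vf_through p v.
have E := congr1 (fun V => V p) (anti X sX); rewrite !app11_phi_h in E.
transitivity (- (X p *m B p *m phi p)); last by rewrite mulmxN mulmxA.
by rewrite mulmxA; exact: E.
Qed.

Section Eigenvalue.
Variable s : R.
Hypotheses (s0 : s != 0) (s2 : s ^+ 2 = - 1 - kappa).

(** As B has only the eigenvalues 0, t and - t, this polynomial in B projects
    onto the eigenspace of t along the others; unlike the eigenspace itself, it
    is visibly smooth. *)
Definition eigenprojector (t : R) p : 'M[R]_n.*2.+1 :=
  (2 * t ^+ 2)^-1 *: (B p *m B p + t *: B p).

Let l0 : - 1 - kappa != 0. Proof. by rewrite -s2 expf_neq0. Qed.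

Lemma xi_eta p : (xi p *m eta p) 0 0 = 1.
Proof. exact: (apc_eta_xi apc). Qed.

Lemma xi_B p : xi p *m B p = 0.
Proof. exact: (involutive_kernel l0 (xi_eta p) (B_B p)). Qed.

Lemma B_eta p u : (u *m B p *m eta p) 0 0 = 0.
Proof.
by rewrite -papp_xi B_sym xi_B /papp trmx0 mulmx0 mxE.
Qed.

Lemma eigenP p t (u : 'rV[R]_n.*2.+1) :
  (u <= eigendistribution B t p)%MS <-> u *m B p = t *: u.
Proof. by split=> /eigenspaceP. Qed.

Lemma eigen_eta p t u : t != 0 -> u *m B p = t *: u -> (u *m eta p) 0 0 = 0.
Proof.
move=> t0 uB; have := B_eta p u; rewrite uB -scalemxAl mxE => /eqP.
by rewrite mulf_eq0 (negPf t0) => /eqP.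
Qed.

Lemma eigen_orthogonal p t r u v : t != r -> u *m B p = t *: u ->
  v *m B p = r *: v -> papp (g p) u v = 0.
Proof.
move=> tr uB vB; have := B_sym p u v; rewrite uB vB pappZl pappZr => /eqP.
by rewrite -subr_eq0 -mulrBl mulf_eq0 subr_eq0 (negPf tr) => /eqP.
Qed.

Lemma eigen_phi p t u : u *m B p = t *: u -> u *m phi p *m B p = - t *: (u *m phi p).
Proof. by move=> uB; rewrite -mulmxA phi_B mulmxN mulmxA uB -scalemxAl scaleNr. Qed.

Lemma eigenprojector_image p t u : t ^+ 2 = - 1 - kappa ->
  u *m eigenprojector t p *m B p = t *: (u *m eigenprojector t p).
Proof.
move=> t2; rewrite -mulmxA scalemxAr; congr (_ *m _).
rewrite /eigenprojector -scalemxAl [RHS]scalerA [t * _]mulrC -[RHS]scalerA.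
congr (_ *: _); rewrite mulmxDl scalerDr -scalemxAl [LHS]addrC scalerA -expr2.
by rewrite t2 {2}B_B -scalemxAl mulmxBl mul1mx -mulmxA xi_B mulmx0 subr0 addrC.
Qed.

Lemma eigenprojector_id p t u : t != 0 -> u *m B p = t *: u ->
  u *m eigenprojector t p = u.
Proof.
move=> t0 uB; rewrite /eigenprojector -scalemxAr mulmxDr mulmxA uB -scalemxAl uB.
rewrite -scalemxAr uB scalerA -expr2 -scalerDl scalerA -mulr2n -[t ^+ 2 *+ 2]mulr_natl.
by rewrite mulVf ?scale1r // mulf_neq0 ?pnatr_eq0 // expf_neq0.
Qed.

Lemma eigenprojector_sym p t u v :
  papp (g p) (u *m eigenprojector t p) v = papp (g p) u (v *m eigenprojector t p).
Proof.
rewrite /eigenprojector -!scalemxAr pappZl pappZr !mulmxDr pappDl pappDr.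
by rewrite -!scalemxAr pappZl pappZr !mulmxA !B_sym.
Qed.

Lemma eigenprojector_sum p u :
  u = u *m eigenprojector s p + u *m eigenprojector (- s) p
      + (u *m eta p) 0 0 *: xi p.
Proof.
have -> : u *m eigenprojector s p + u *m eigenprojector (- s) p =
    u *m (1%:M - eta p *m xi p).
  rewrite -mulmxDr /eigenprojector sqrrN -scalerDr scaleNr addrACA subrr addr0.
  have -> : B p *m B p + B p *m B p = 2 *: (B p *m B p) by rewrite scaler_nat mulr2n.
  by rewrite B_B s2 !scalerA -mulrA mulVf ?scale1r // mulf_neq0 ?pnatr_eq0.
rewrite mulmxBr mulmx1 mulmxA.
by rewrite [u *m eta p]mx11_scalar mul_scalar_mx -[in RHS]mx11_scalar subrK.
Qed.

Lemma smooth_eigenprojector t X : smooth_vf X -> smooth_vf (app11 (eigenprojector t) X).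
Proof.
move=> sX; have sBX := smooth_app11_B sX.
rewrite (_ : app11 _ X = fun p => (2 * t ^+ 2)^-1 *:
    (app11 B (app11 B X) p + t *: app11 B X p)); last first.
  apply/funext => p; rewrite /app11 /eigenprojector -scalemxAr mulmxDr mulmxA.
  by rewrite -scalemxAr.
apply: smooth_vf_scale; first exact: smooth_fun_cst.
apply: smooth_vf_add; first exact: smooth_app11_B.
by apply: smooth_vf_scale => //; exact: smooth_fun_cst.
Qed.

Local Notation D := (eigendistribution B).

Lemma section_field t X : section_of (D t) X ->
  smooth_vf X /\ app11 phi (app11 h X) = t *: X.
Proof.
move=> [sX DX]; split=> //; rewrite app11_phi_h; apply/funext => p.
exact: ((eigenP p t (X p)).1 (DX p)).
Qed.

Lemma projected_section t X : t ^+ 2 = - 1 - kappa -> smooth_vf X ->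
  section_of (D t) (app11 (eigenprojector t) X).
Proof.
move=> t2 sX; split=> [|p]; first exact: smooth_eigenprojector.
by apply/eigenP; exact: eigenprojector_image.
Qed.

(** Y stays orthogonal to xi, so this is - g (Y, nabla_X xi), where
    nabla_X xi = s X - phi X and phi X belongs to the eigenspace of - s, which
    is orthogonal to Y. *)
Lemma nabla_xi_component X Y p : section_of (D s) X -> section_of (D s) Y ->
  papp (g p) (nabla X Y p) (xi p) = - s * app2 g X Y p.
Proof.
move=> DX DY; have [sX BX] := section_field DX; have [sY BY] := section_field DY.
have [_ _ met] := lc; have [nxi _ _ _ _] := phi_h_structure.
have sx := apc_xi apc.
have E := met X Y xi sX sY sx p.
have Y0 : app2 g Y xi = fun=> 0.
  apply/funext => q; rewrite eta_field; apply: (eigen_eta s0).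
  exact: ((eigenP q s (Y q)).1 (DY.2 q)).
have V0 : vf_der X (app2 g Y xi) p = 0 by rewrite Y0 vf_der_cst.
have XB : X p *m B p = s *: X p by exact: ((eigenP p s (X p)).1 (DX.2 p)).
have YB : Y p *m B p = s *: Y p by exact: ((eigenP p s (Y p)).1 (DY.2 p)).
have Nss : s != - s by rewrite -subr_eq0 opprK -mulr2n mulrn_eq0.
have N : papp (g p) (Y p) (nabla X xi p) = s * papp (g p) (X p) (Y p).
  have -> : nabla X xi p = s *: X p + - (X p *m phi p) by rewrite nxi // BX.
  rewrite pappDr pappZr -scaleN1r pappZr.
  by rewrite (eigen_orthogonal Nss YB (eigen_phi XB)) mulr0 addr0 papp_sym.
have : 0 = papp (g p) (nabla X Y p) (xi p) + papp (g p) (Y p) (nabla X xi p).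
  exact: (etrans (esym V0) E).
by rewrite N /app2 => /eqP; rewrite eq_sym addr_eq0 mulNr => /eqP.
Qed.

Lemma nabla_eigendistribution X Y p : section_of (D s) X -> section_of (D s) Y ->
  nabla X Y p = nabla X Y p *m eigenprojector s p + (- s * app2 g X Y p) *: xi p.
Proof.
move=> DX DY; have [sX BX] := section_field DX; have [sY BY] := section_field DY.
rewrite -(nabla_xi_component p DX DY) papp_xi {1}(eigenprojector_sum p (nabla X Y p)).
suff -> : nabla X Y p *m eigenprojector (- s) p = 0 by rewrite addr0.
apply: (@papp_eq0 p) => v; have [V sV <-] := vf_through p v.
have Ns2 : (- s) ^+ 2 = - 1 - kappa by rewrite sqrrN.
have [sZ BZ] := section_field (projected_section Ns2 sV).
have [_ _ _ _ main] := phi_h_structure.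
rewrite eigenprojector_sym; exact: (main s X Y _ p s0 sX sY sZ BX BY BZ).
Qed.

Lemma orthogonal_complementP (L : tangent_distribution M) p u :
  (u <= orthogonal_complement g L p)%MS <->
  forall v, (v <= L p)%MS -> papp (g p) u v = 0.
Proof.
rewrite /orthogonal_complement; split=> [/sub_kermxP u0 v /submxP[c ->]|u0].
  by rewrite /papp trmx_mul !mulmxA -[u *m _ *m _]mulmxA u0 mul0mx mxE.
apply/sub_kermxP; apply/rowP => j; rewrite [RHS]mxE mulmxA.
have := u0 (row j (L p)) (row_sub j (L p)).
by rewrite /papp tr_row colE mulmxA -colE mxE.
Qed.

Lemma eigen_nondegenerate p : (D s p :&: orthogonal_complement g (D s) p)%MS = 0.
Proof.
apply/eqP; rewrite -submx0; apply/rV_subP => u; rewrite sub_capmx => /andP[/eigenP uB].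
move=> /orthogonal_complementP u0; rewrite submx0; apply/eqP; apply: (@papp_eq0 p) => v.
rewrite -(eigenprojector_id s0 uB) eigenprojector_sym; apply: u0.
by apply/eigenP; exact: eigenprojector_image.
Qed.

Lemma eigen_xi_orthogonal p : (xi p <= orthogonal_complement g (D s) p)%MS.
Proof.
apply/orthogonal_complementP => v /eigenP vB.
by rewrite papp_sym papp_xi; exact: (eigen_eta s0 vB).
Qed.

(** The mean curvature field is - s xi. *)
Lemma eigen_totally_umbilical : totally_umbilical_leaves g nabla (D s).
Proof.
split; first exact: eigen_nondegenerate.
exists (fun p => - s *: xi p).
  split; first by apply: smooth_vf_scale; [exact: smooth_fun_cst|exact: (apc_xi apc)].
  by move=> p; apply: scalemx_sub; exact: eigen_xi_orthogonal.
move=> X Y DX DY p; rewrite /second_fundamental_form /normal_part.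
rewrite nabla_eigendistribution // mulmxDl proj_mx_0 ?add0r; first last.
- by apply/eigenP; exact: eigenprojector_image.
- by rewrite capmxC; exact: eigen_nondegenerate.
rewrite proj_mx_id; first by rewrite scalerA mulrC.
- by rewrite capmxC; exact: eigen_nondegenerate.
by apply: scalemx_sub; exact: eigen_xi_orthogonal.
Qed.

Lemma nabla_section X Y : section_of (D s) X -> section_of (D s) Y ->
  section_of (fun p => (D s p + xi p)%MS) (nabla X Y).
Proof.
move=> DX DY; split; first by apply: smooth_vf_nabla; [case: DX|case: DY].
move=> p; rewrite nabla_eigendistribution //; apply: addmx_sub_adds.
  by apply/eigenP; exact: eigenprojector_image.
exact: scalemx_sub.
Qed.

(** The component of nabla_X Y along xi is symmetric in X and Y, so it
    disappears from the bracket. *)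
Lemma eigen_integrable : integrable_subbundle (D s).
Proof.
move=> X Y DX DY; have [sX _] := DX; have [sY _] := DY.
split; first exact: smooth_bracketsP.
move=> p; rewrite bracket_nabla //.
have -> : (nabla X Y - nabla Y X) p =
    (nabla X Y p - nabla Y X p) *m eigenprojector s p.
  rewrite -[LHS]/(nabla X Y p - nabla Y X p).
  have C : app2 g Y X p = app2 g X Y p by exact: papp_sym.
  rewrite {1}(nabla_eigendistribution p DX DY) {1}(nabla_eigendistribution p DY DX).
  by rewrite C opprD addrACA subrr addr0 -mulmxBl.
by apply/eigenP; exact: eigenprojector_image.
Qed.

Lemma eigen_legendre X Y p : section_of (D s) X -> section_of (D s) Y ->
  ext_d eta X Y p = 0.
Proof.
move=> DX DY; have [sX _] := DX; have [sY _] := DY; rewrite ext_d_phi //.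
have XB : X p *m B p = s *: X p by exact: ((eigenP p s (X p)).1 (DX.2 p)).
have YB : Y p *m B p = s *: Y p by exact: ((eigenP p s (Y p)).1 (DY.2 p)).
apply: eigen_orthogonal XB (eigen_phi YB).
by rewrite -subr_eq0 opprK -mulr2n mulrn_eq0.
Qed.

Lemma B_eta0 p : B p *m eta p = 0.
Proof.
apply/row_matrixP => i; rewrite rowE mulmxA row0; apply/matrixP => a b.
by rewrite !ord1 B_eta mxE.
Qed.

Lemma eigen_rank_le p t : t != 0 -> (\rank (D t p) <= \rank (D (- t) p))%N.
Proof.
move=> t0; set W := D t p.
have WB : W *m B p = t *: W by apply/eigenspaceP.
have Weta : W *m eta p = 0.
  apply/eqP; have := B_eta0 p => /(congr1 (mulmx W)); rewrite mulmx0 mulmxA WB.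
  by rewrite -scalemxAl => /eqP; rewrite scaler_eq0 (negPf t0).
have Wphi : (W *m phi p <= D (- t) p)%MS.
  by apply/eigenspaceP; rewrite -mulmxA phi_B mulmxN mulmxA WB -scalemxAl scaleNr.
have WW : W *m phi p *m phi p = W.
  by rewrite -mulmxA phi_phi mulmxBr mulmx1 mulmxA Weta mul0mx subr0.
by rewrite -{1}WW (leq_trans (mxrankM_maxl _ _)) // mxrankS.
Qed.

(** phi exchanges the two eigenspaces, so they have the same dimension, and
    together with xi they span the tangent space. *)
Lemma eigen_rank p : \rank (D s p) = n.
Proof.
have Ns0 : - s != 0 by rewrite oppr_eq0.
have le1 := eigen_rank_le p s0; have le2 := eigen_rank_le p Ns0.
rewrite opprK in le2.
have full : (1%:M <= D s p + D (- s)%R p + xi p)%MS.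
  apply/rV_subP => u _; rewrite (eigenprojector_sum p u).
  apply: addmx_sub_adds; last exact: scalemx_sub.
  apply: addmx_sub_adds; apply/eigenP; apply: eigenprojector_image => //.
  by rewrite sqrrN.
have up := leq_trans (mxrankS full) (mxrank_adds_leqif _ _).1.
have rxi : (\rank (xi p) <= 1)%N by exact: rank_leq_row.
have cap0 : (D s p :&: D (- s)%R p)%MS = 0.
  apply/eqP; rewrite -submx0; apply/rV_subP => u; rewrite sub_capmx.
  move=> /andP[/eigenP uB /eigenP]; rewrite uB => /eqP.
  by rewrite -subr_eq0 -scalerBl opprK scaler_eq0 -mulr2n mulrn_eq0 (negPf s0) submx0.
have rsum := mxrank_disjoint_sum cap0.
have sub : (D s p + D (- s)%R p <= kermx (eta p))%MS.
  rewrite addsmx_sub; apply/andP; split; apply/rV_subP => u /eigenP uB;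
    apply/sub_kermxP; apply/matrixP => a b; rewrite !ord1 [RHS]mxE.
    exact: (eigen_eta s0 uB).
  exact: (eigen_eta Ns0 uB).
have reta : (0 < \rank (eta p))%N.
  rewrite lt0n mxrank_eq0; apply/eqP => eta0.
  by have := xi_eta p; rewrite eta0 mulmx0 mxE => /eqP; rewrite eq_sym oner_eq0.
have down := mxrankS sub; rewrite mxrank_ker rsum in down.
rewrite mxrank1 rsum in up.
by lia.
Qed.

(** Smooth fields through a basis of the eigenspace at p are projected onto
    the eigendistribution; they remain independent as long as a determinant,
    which is continuous in the chart, does not vanish. *)
Lemma eigen_subbundle : subbundle n (D s).
Proof.
move=> p; set e := chart_at p; set x0 := cto e p.
have ea : atlas M e by exact: chart_at_atlas.
have ep : cdom e p by exact: chart_at_dom.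
have [F0 F0D F0free] := row_basis_of_rank (eigen_rank p).
pose X i := projT1 (cid2 (vf_through p (row i F0))).
have XP i : smooth_vf (X i) /\ X i p = row i F0.
  by rewrite /X; case: cid2.
pose F i := app11 (eigenprojector s) (X i).
have sF i : smooth_vf (F i) by apply: smooth_eigenprojector; exact: ((XP i).1).
have Fp i : F i p = row i F0.
  rewrite /F /app11 (XP i).2; apply: eigenprojector_id => //.
  by apply/eigenP; apply: submx_trans (row_sub i F0) _; case/andP: F0D.
have FD i q : (F i q <= D s q)%MS by apply/eigenP; exact: eigenprojector_image.
pose rep x : 'M[R]_(n, n.*2.+1) := \matrix_(i < n) vf_rep e (F i) x.
have Crep : Ck_on 0 (ccod e) rep.
  apply/(Ck_on_mxP 0 rep (ccod_open (c := e))) => i j.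
  have := (Ck_on_mxP 0 _ (ccod_open (c := e))).1 ((smooth_vfP (F i)).1 (sF i) e ea 0%N) 0 j.
  apply: (Ck_on_eq (ccod_open (c := e))) => x _.
  by rewrite /rep mxE.
(* A right inverse of the basis at p. *)
pose C := pinvmx F0.
have Cdet : {for x0, continuous (fun x => \det (rep x *m C) : R^o)}.
  apply: (Ck_on_det (ccod_open (c := e)) (Ck_on_mulmx (ccod_open (c := e)) Crep
    (Ck_on_cst 0 _ C))).
  exact: cto_in.
have rep0 : rep x0 = F0.
  by apply/row_matrixP => i; rewrite rowK vf_rep_self Fp.
pose V := [set q | cdom e q /\ \det (rep (cto e q) *m C) != 0].
have nV : nbhs p V.
  apply: filterI; first by apply: open_nbhs_nbhs; split=> //; exact: cdom_open.
  apply: (cto_continuous ep) (fun x => \det (rep x *m C) != 0) _.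
  apply: Cdet (fun y => y != 0) _; rewrite -/x0 rep0 mulmxVp // det1.
  by apply: open_nbhs_nbhs; split; [exact: open_neq|exact: oner_neq0].
exists (interior V); first by split; [exact: open_interior|].
exists F => [i e' e'a k|q /interior_subset[eq dq]].
  by apply: Ck_onS (sF i e' e'a k) => x [].
have rF : \rank (\matrix_(i < n) F i q) = n.
  apply/eqP; rewrite eqn_leq rank_leq_row /=.
  have E : rep (cto e q) *m C = (\matrix_(i < n) F i q) *m (frame e q *m C).
    rewrite mulmxA; congr (_ *m _); apply/row_matrixP => i.
    by rewrite row_mul !rowK vf_rep_cto.
  have : rep (cto e q) *m C \in unitmx by rewrite unitmxE unitfE.
  by rewrite -row_free_unit E /row_free => /eqP {1}<-; exact: mxrankM_maxl.
split; first exact: eigen_rank.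
have sub : (\matrix_(i < n) F i q <= D s q)%MS by apply/row_subP => i; rewrite rowK.
by rewrite -(mxrank_leqif_eq sub).2 rF eigen_rank.
Qed.

Lemma eigen_legendre_foliation : legendre_foliation n eta (D s).
Proof.
split; [exact: eigen_subbundle| |exact: eigen_integrable|].
  move=> p; apply/rV_subP => u /eigenP uB; apply/sub_kermxP; apply/matrixP => a b.
  by rewrite !ord1 [RHS]mxE; exact: (eigen_eta s0 uB).
by move=> X Y DX DY p; exact: eigen_legendre.
Qed.

End Eigenvalue.

End KappaMuManifold.

Theorem theorem5p1 (R : realType) (n : nat) (M : manifold R n.*2.+1)
    (kappa mu : R) (phi : tensor11 M) (xi : vfield M) (eta : form1 M)
    (g : tensor02 M) (h : tensor11 M) (nabla : vfield M -> vfield M -> vfield M)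
    (lambda := Num.sqrt (-1 - kappa))
    (D := eigendistribution (phi_h phi h)) :
  paracontact_kappa_mu kappa mu phi xi eta g h nabla ->
  kappa < -1 ->
  constant_index g (D lambda) ->
  constant_index g (D (- lambda)) ->
  [/\ legendre_foliation n eta (D lambda) /\
      legendre_foliation n eta (D (- lambda)),
      orthogonal_distributions g (D lambda) (D (- lambda)),
      totally_umbilical_leaves g nabla (D lambda) /\
      totally_umbilical_leaves g nabla (D (- lambda)) &
      forall s : R, s = lambda \/ s = - lambda ->
      forall X Y : vfield M, section_of (D s) X -> section_of (D s) Y ->
        section_of (fun p => (D s p + xi p)%MS) (nabla X Y)].
Proof.
move=> pkm k1 _ _.
have k0 : 0 < - 1 - kappa by lra.
have l2 : lambda ^+ 2 = - 1 - kappa by rewrite sqr_sqrtr // ltW.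
have l0 : lambda != 0 by rewrite gt_eqF // sqrtr_gt0.
have Nl2 : (- lambda) ^+ 2 = - 1 - kappa by rewrite sqrrN.
have Nl0 : - lambda != 0 by rewrite oppr_eq0.
have BE p : phi_h phi h p = phi_h phi h p by [].
split.
- split; [exact: (eigen_legendre_foliation pkm BE l0 l2)|].
  exact: (eigen_legendre_foliation pkm BE Nl0 Nl2).
- move=> p u v /eigenspaceP uB /eigenspaceP vB.
  apply: (eigen_orthogonal pkm BE _ uB vB).
  by rewrite -subr_eq0 opprK -mulr2n mulrn_eq0.
- split; [exact: (eigen_totally_umbilical pkm BE l0 l2)|].
  exact: (eigen_totally_umbilical pkm BE Nl0 Nl2).
- move=> s [->|->] X Y DX DY; first exact: (nabla_section pkm BE l0 l2).
  exact: (nabla_section pkm BE Nl0 Nl2).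
Qed.
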